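(* Let $S$ be a Damek--Ricci space in the half-space model, and let $\eta=L_{(\bar V,\bar Z,\bar t)}\circ\gamma$, where $(\bar V,\bar Z,\bar t)\in S$ and $\gamma$ is the prolongation of the unit speed geodesic $\hat\gamma$ starting from $e$ with unit initial velocity $\hat\gamma'(0)=(v,0,s)\in T_eS$. Then the function $$D_{\circledast}^{\eta}(V,Z,t)=\frac1t\left(\left(2s\sqrt{\bar t}-\langle V-\bar V,v\rangle\right)^2+\big\|[V-\bar V,v]\big\|^2\right)$$ on $S$ is isoparametric. Moreover: (i) The function $D_{\circledast}^{\eta}$ has no maximal value. (ii) If $v\neq0$, that is, if the image of $\eta$ is a parabola (with its point at infinity), then the minimal value of $D_{\circledast}^{\eta}$ is $0$. In particular, its focal variety is $$\mathcal F_{\circledast}^{\eta}=\{(V,Z,t)\in\mathfrak v\oplus\mathfrak z\times\mathbb R_+\mid[V-\bar V,v]=0\text{ and }\langle V-\bar V,v\rangle=2s\sqrt{\bar t}\}.$$ In the half-space model, the minimal submanifold $\mathcal F_{\circledast}^{\eta}$ is represented by the intersection of the half-space model and the translate of the linear subspace $(\{u\in\mathfrak v:[v,u]=0\}\cap v^{\perp})\oplus\mathfrak z\oplus\mathbb R=(J_{\mathfrak z}v\oplus\mathbb Rv)^{\perp}$ by the vector $\bar V+(2s\sqrt{\bar t}/\|v\|^2)v$, which is an affine subspace of dimension $n=\dim\mathfrak v$. (iii) If $v=0$ and $s=\pm1$, meaning that the image of $\eta$ is a straight line perpendicular to the boundary $\mathfrak v\oplus\mathfrak z$ of the model, then $D_{\circledast}^{\eta}(V,Z,t)=4\bar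 t/t$ does not possess any minimal value, and as a result it has an empty focal variety. The level sets of $D_{\circledast}^{\eta}$ are then parallel horospheres, represented by parallel hyperplanes perpendicular to $\mathfrak a$ in the half-space model.
   Context: Isoparametric function: a smooth $F\colon M\to\mathbb R$ on a Riemannian manifold is isoparametric if there exist a continuous function $a$ and a $\mathcal C^2$ function $b$ on $F(M)$ with $\Delta F=a\circ F$, $\|\nabla F\|^2=b\circ F$. The singular level sets of an isoparametric function are its focal varieties. Damek--Ricci space: let $\mathfrak s=\mathfrak v\oplus\mathfrak z\oplus\mathfrak a$ be an orthogonal decomposition of a finite-dimensional Euclidean space $(\mathfrak s,\langle\,,\rangle)$ with $\mathfrak a=\mathbb RA$, $\|A\|=1$, $n=\dim\mathfrak v$, $m=\dim\mathfrak z$ (either may be $0$). Let $J$ be a representation on $\mathfrak v$ of the Clifford algebra $\mathrm{Cl}(\mathfrak z,q)$ of $q(Z)=-\langle Z,Z\rangle$ with $\|J_ZV\|=\|Z\|\|V\|$; $J_{\mathfrak z}v=\{J_Zv:Z\in\mathfrak z\}$. The Lie bracket on $\mathfrak s$ is determined by $\langle[U,V],Z\rangle=\langle J_ZU,V\rangle$ with $[U,V]\in\mathfrak z$ for $U,V\in\mathfrak v$, $Z\in\mathfrak z$; $[\mathfrak v\oplus\mathfrak z,\mathfrak z]=0$; $[A,V]=\frac12V$ for $V\in\mathfrak v$; $[A,Z]=Z$ for $Z\in\mathfrak z$. The simply connected Lie group $S$ with Lie algebra $\mathfrak s$ and the left-invariant metric induced by $\langle\,,\rangle$ is the Damek--Ricci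 space. Half-space model: $S$ is identified with $\mathfrak v\oplus\mathfrak z\times\mathbb R_+\subset\mathfrak v\oplus\mathfrak z\oplus\mathbb R\cong\mathfrak s$ via $(V,Z,t)\mapsto\exp(V+Z)\exp((\ln t)A)$; $e=(0,0,1)$; $(v,z,s)\in T_eS$ means $v+z+sA$. The left translation by $(\bar V,\bar Z,\bar t)\in S$ extends to the affine map $L_{(\bar V,\bar Z,\bar t)}(V,Z,t)=(\bar V+\sqrt{\bar t}V,\ \bar Z+\bar tZ+\frac12\sqrt{\bar t}[\bar V,V],\ \bar tt)$ of $\mathfrak v\oplus\mathfrak z\oplus\mathbb R$ and to the projective closure $\mathbf P(\mathfrak s\oplus\mathbb R)$ of $\mathfrak s$. Prolongation: for a unit vector $(v,z,s)\in T_eS$ the unit speed geodesic from $e$ with this initial velocity is $\hat\gamma(t)=\gamma(\tanh(t/2))$, where $\gamma(\theta)=\left(\frac{2\theta(1-s\theta)}{\chi(\theta)}v+\frac{2\theta^2}{\chi(\theta)}J_zv,\frac{2\theta}{\chi(\theta)}z,\frac{1-\theta^2}{\chi(\theta)}\right)$, $\chi(\theta)=(1-s\theta)^2+\|z\|^2\theta^2$; its prolongation is the continuous extension $\gamma\colon\mathbb R\mathbf P^1\to\mathbf P(\mathfrak s\oplus\mathbb R)$. Horospheres are the level sets of Busemann functions. *)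

(* Defs.v *)
From HB Require Import structures.
From mathcomp Require Import all_boot all_order all_algebra.
From mathcomp Require Import all_classical all_reals all_analysis.
From mathcomp Require Import lra.

Set Implicit Arguments.
Unset Strict Implicit.
Unset Printing Implicit Defensive.

Import Order.TTheory GRing.Theory Num.Theory.
Import numFieldNormedType.Exports.

Local Open Scope classical_set_scope.
Local Open Scope ring_scope.

(** Euclidean structure of ['rV[R]_k]. The library norm [`|x|] on matrices is
    the sup norm; it is used for its topology only. *)

Definition dot (R : realType) (k : nat) (x y : 'rV[R]_k) : R :=
  \sum_(i < k) x 0 i * y 0 i.

Definition enorm (R : realType) (k : nat) (x : 'rV[R]_k) : R :=
  Num.sqrt (dot x x).

Definition orthocomp (R : realType) (k : nat) (X : set 'rV[R]_k)
  : set 'rV[R]_k := [set x | forall y, X y -> dot x y = 0].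

Definition affine_subspace (R : realType) (k d : nat) (A : set 'rV[R]_k) : Prop :=
  exists (a : 'rV[R]_k) (K : {vspace 'rV[R]_k}),
    \dim K = d /\ A = [set a + x | x in [set x | x \in K]].

(** Differentiable functions. Requiring every iterated directional derivative
    to be Frechet differentiable on the open set [U] is C^oo regularity. *)

Definition smooth_on (R : realType) (V W : normedModType R)
    (U : set V) (f : V -> W) : Prop :=
  forall (vs : seq V) (x : V), U x ->
    differentiable (foldr (fun v (g : V -> W) => fun y => 'D_v g y) f vs) x.

(** [D] need not be open (it will be the range of a function): [b] is C^2 on
    [D] when it extends to a C^2 function on a neighbourhood of [D]. *)
Definition C2_on (R : realType) (D : set R) (b : R -> R) : Prop :=
  exists (O : set R) (g : R -> R),
    [/\ open O, D `<=` O, (forall x, D x -> g x = b x) &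
        forall x, O x ->
          [/\ derivable g x 1, derivable (derive1 g) x 1 &
             {for x, continuous (derive1 (derive1 g))}]].

(** Riemannian geometry of an open set [U] of ['rV[R]_N] whose metric at [p]
    has the Gram matrix [G p] in the standard coordinates. *)

Definition inner (R : realType) (N : nat) (G : 'rV[R]_N -> 'M[R]_N)
    (p X Y : 'rV[R]_N) : R := (X *m G p *m Y^T) 0 0.

Definition grad (R : realType) (N : nat) (G : 'rV[R]_N -> 'M[R]_N)
    (F : 'rV[R]_N -> R) (p : 'rV[R]_N) : 'rV[R]_N :=
  (\row_i 'D_(delta_mx 0 i) F p) *m invmx (G p).

Definition laplacian (R : realType) (N : nat) (G : 'rV[R]_N -> 'M[R]_N)
    (F : 'rV[R]_N -> R) (p : 'rV[R]_N) : R :=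
  (Num.sqrt (\det (G p)))^-1 *
  \sum_(i < N) 'D_(delta_mx 0 i)
                 (fun q => Num.sqrt (\det (G q)) * grad G F q 0 i) p.

Definition isoparametric (R : realType) (N : nat) (G : 'rV[R]_N -> 'M[R]_N)
    (U : set 'rV[R]_N) (F : 'rV[R]_N -> R) : Prop :=
  smooth_on U F /\
  exists a b : R -> R,
    [/\ {within F @` U, continuous a}, C2_on (F @` U) b &
        forall p, U p ->
          laplacian G F p = a (F p) /\
          inner G p (grad G F p) (grad G F p) = b (F p)].

Definition level_set (T R : Type) (U : set T) (F : T -> R) (c : R) : set T :=
  [set p | U p /\ F p = c].

(** Singular level sets, i.e. level sets containing a critical point. *)
Definition focal_variety (R : realType) (N : nat) (G : 'rV[R]_N -> 'M[R]_N)
    (U : set 'rV[R]_N) (F : 'rV[R]_N -> R) (A : set 'rV[R]_N) : Prop :=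
  exists c : R, A = level_set U F c /\ exists p, A p /\ grad G F p = 0.

Definition has_max_on (R : realType) (T : Type) (U : set T) (F : T -> R) : Prop :=
  exists p, U p /\ forall q, U q -> F q <= F p.

Definition is_min_on (R : realType) (T : Type) (U : set T) (F : T -> R) (c : R)
  : Prop := (exists p, U p /\ F p = c) /\ forall q, U q -> c <= F q.

(** [<nabla_X Y, xi>] at [p] for the constant-coefficient vector fields
    [X], [Y], [xi] (Koszul's formula; the three Lie brackets vanish). *)
Definition koszul (R : realType) (N : nat) (G : 'rV[R]_N -> 'M[R]_N)
    (p X Y xi : 'rV[R]_N) : R :=
  2^-1 * ('D_X (fun q => inner G q Y xi) p + 'D_Y (fun q => inner G q X xi) p
          - 'D_xi (fun q => inner G q X Y) p).

Definition jac (R : realType) (k N : nat) (phi : 'rV[R]_k -> 'rV[R]_N)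
    (y : 'rV[R]_k) : 'M[R]_(k, N) := \matrix_(i < k) 'D_(delta_mx 0 i) phi y.

Definition first_form (R : realType) (k N : nat) (G : 'rV[R]_N -> 'M[R]_N)
    (phi : 'rV[R]_k -> 'rV[R]_N) (y : 'rV[R]_k) : 'M[R]_k :=
  jac phi y *m G (phi y) *m (jac phi y)^T.

(** [<nabla_(d_i phi) d_j phi, xi>], which for a normal vector [xi] is the
    [(i, j)] coefficient of the second fundamental form in the direction [xi]. *)
Definition second_form (R : realType) (k N : nat) (G : 'rV[R]_N -> 'M[R]_N)
    (phi : 'rV[R]_k -> 'rV[R]_N) (y : 'rV[R]_k) (xi : 'rV[R]_N) (i j : 'I_k) : R :=
  inner G (phi y)
    ('D_(delta_mx 0 i) (fun y' => 'D_(delta_mx 0 j) phi y') y) xi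
  + koszul G (phi y) (row i (jac phi y)) (row j (jac phi y)) xi.

(** [A] is a [k]-dimensional embedded submanifold of [U] whose mean curvature
    vector field vanishes. *)
Definition minimal_submanifold (R : realType) (k N : nat)
    (G : 'rV[R]_N -> 'M[R]_N) (U A : set 'rV[R]_N) : Prop :=
  A `<=` U /\
  forall p, A p ->
    exists (O : set 'rV[R]_k) (W : set 'rV[R]_N)
           (phi : 'rV[R]_k -> 'rV[R]_N) (psi : 'rV[R]_N -> 'rV[R]_k),
      [/\ open O /\ smooth_on O phi,
          open W /\ W p,
          phi @` O = A `&` W,
          {within A `&` W, continuous psi} /\ (forall y, O y -> psi (phi y) = y) &
          forall y, O y ->
            row_free (jac phi y) /\
            forall xi : 'rV[R]_N,
              (forall i, inner G (phi y) (row i (jac phi y)) xi = 0) ->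
              \sum_(i < k) \sum_(j < k)
                invmx (first_form G phi y) i j * second_form G phi y xi i j = 0].

(** Riemannian distance: infimum of the lengths of piecewise C^1 curves,
    a piece being a C^1 curve restricted to [[0, 1]]. *)

Definition C1_curve_in (R : realType) (N : nat) (U : set 'rV[R]_N)
    (c : R -> 'rV[R]_N) : Prop :=
  [/\ forall x, derivable c x 1, continuous (derive1 c) &
      forall x, 0 <= x <= 1 -> U (c x)].

Definition curve_length (R : realType) (N : nat) (G : 'rV[R]_N -> 'M[R]_N)
    (c : R -> 'rV[R]_N) : R :=
  \int[lebesgue_measure]_(x in `[0, 1])
    Num.sqrt (inner G (c x) (derive1 c x) (derive1 c x)).

Inductive joined_by_length (R : realType) (N : nat) (G : 'rV[R]_N -> 'M[R]_N)
    (U : set 'rV[R]_N) : 'rV[R]_N -> 'rV[R]_N -> R -> Prop :=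
| JoinedNil p : U p -> joined_by_length G U p p 0
| JoinedCons (c : R -> 'rV[R]_N) q l :
    C1_curve_in U c -> joined_by_length G U (c 1) q l ->
    joined_by_length G U (c 0) q (curve_length G c + l).

Definition rdist (R : realType) (N : nat) (G : 'rV[R]_N -> 'M[R]_N)
    (U : set 'rV[R]_N) (p q : 'rV[R]_N) : R :=
  inf [set l | joined_by_length G U p q l].

Definition geodesic_ray (R : realType) (N : nat) (G : 'rV[R]_N -> 'M[R]_N)
    (U : set 'rV[R]_N) (c : R -> 'rV[R]_N) : Prop :=
  (forall x, 0 <= x -> U (c x)) /\
  forall x y, 0 <= x -> 0 <= y -> rdist G U (c x) (c y) = `|x - y|.

Definition busemann (R : realType) (N : nat) (G : 'rV[R]_N -> 'M[R]_N)
    (U : set 'rV[R]_N) (c : R -> 'rV[R]_N) (p : 'rV[R]_N) : R :=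
  lim ((rdist G U p (c x) - x) @[x --> +oo]).

(** Parallel horospheres are level sets of one and the same Busemann function. *)
Definition parallel_horospheres (R : realType) (N : nat)
    (G : 'rV[R]_N -> 'M[R]_N) (U : set 'rV[R]_N) (HH : set (set 'rV[R]_N))
  : Prop :=
  exists c, geodesic_ray G U c /\
    forall H, HH H -> exists k : R, H = level_set U (busemann G U c) k.

(** Projective closure of ['rV[R]_N]. The point of a projective space with
    homogeneous coordinates [y] is encoded by the orthogonal projection onto
    the line spanned by [y]; the projective space is thus topologically embedded
    in a space of matrices. *)

Definition hpoint (R : realType) (k : nat) (y : 'rV[R]_k) : 'M[R]_k :=
  (dot y y)^-1 *: (y^T *m y).

Definition affine_point (R : realType) (N : nat) (x : 'rV[R]_N) : 'M[R]_(N + 1) :=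
  hpoint (row_mx x 1%:M).

Definition infinity_point (R : realType) (N : nat) (x : 'rV[R]_N)
  : 'M[R]_(N + 1) := hpoint (row_mx x (0 : 'M[R]_1)).

(** Matrix, acting on row vectors, of the linear map [(x, w) |-> (f_lin x + w f(0), w)]
    for an affine map [f] with linear part [f_lin]. *)
Definition affine_mx (R : realType) (N : nat) (f : 'rV[R]_N -> 'rV[R]_N)
  : 'M[R]_(N + 1) :=
  block_mx (\matrix_(i < N) (f (delta_mx 0 i) - f 0)) 0 (f 0) 1%:M.

(** If [M] is invertible, this maps [hpoint y] to [hpoint (y *m M)]. *)
Definition proj_action (R : realType) (k : nat) (M P : 'M[R]_k) : 'M[R]_k :=
  (\tr (M^T *m P *m M))^-1 *: (M^T *m P *m M).

Definition proj_extension (R : realType) (N : nat) (f : 'rV[R]_N -> 'rV[R]_N)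
  : 'M[R]_(N + 1) -> 'M[R]_(N + 1) := proj_action (affine_mx f).

Definition parabola_with_infinity (R : realType) (N : nat)
    (C : set 'M[R]_(N + 1)) : Prop :=
  exists a u w : 'rV[R]_N,
    [/\ u != 0, w != 0, dot u w = 0 &
        C = [set affine_point (a + x *: u + x ^+ 2 *: w) | x in [set: R]]
            `|` [set infinity_point w]].

Definition line_with_infinity (R : realType) (N : nat) (u : 'rV[R]_N)
    (C : set 'M[R]_(N + 1)) : Prop :=
  u != 0 /\ exists a : 'rV[R]_N,
    C = [set affine_point (a + x *: u) | x in [set: R]] `|` [set infinity_point u].

(** Damek-Ricci spaces: [v] and [z] are identified with ['rV[R]_n] and
    ['rV[R]_m] through orthonormal bases; [n] and [m] may be [0]. *)

Record clifford_module (R : realType) (n m : nat) := CliffordModule {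
  cliff :> 'rV[R]_m -> 'rV[R]_n -> 'rV[R]_n;
  cliff_linear : forall Z, linear (cliff Z);
  cliff_linear_l : forall V, linear (fun Z => cliff Z V);
  cliff_sq : forall Z V, cliff Z (cliff Z V) = - dot Z Z *: V;
  cliff_norm : forall Z V, enorm (cliff Z V) = enorm Z * enorm V
}.

Definition bracket (R : realType) (n m : nat) (J : clifford_module R n m)
    (U V : 'rV[R]_n) : 'rV[R]_m :=
  \row_(i < m) dot (J (delta_mx 0 i) U) V.

Lemma bracketP (R : realType) (n m : nat) (J : clifford_module R n m)
    (U V : 'rV[R]_n) (Z : 'rV[R]_m) :
  dot (bracket J U V) Z = dot (J Z U) V.
Proof.
pose L : 'rV[R]_m -> 'rV[R]_n := fun Z => J Z U.
have L0 : L 0 = 0.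
  have := cliff_linear_l J U (-1) 0 0.
  by rewrite scaler0 add0r scaleN1r addNr.
have Lsum : L Z = \sum_i Z 0 i *: L (delta_mx 0 i).
  rewrite [in LHS](row_sum_delta Z).
  elim/big_rec2: _ => // i y1 y2 _ <-.
  by have := cliff_linear_l J U (Z 0 i) (delta_mx 0 i) y2.
rewrite -/(L Z) Lsum /dot.
under [RHS]eq_bigr => j _ do rewrite summxE big_distrl /=.
rewrite exchange_big /=; apply: eq_bigr => i _.
rewrite mxE /dot mulrC big_distrr /=; apply: eq_bigr => j _.
by rewrite !mxE mulrA.
Qed.

Lemma bracketZ (R : realType) (n m : nat) (J : clifford_module R n m)
    (c : R) (V : 'rV[R]_n) : bracket J (c *: V) V = 0.
Proof.
have dD (x y z : 'rV[R]_n) : dot (x + y) z = dot x z + dot y z.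
  by rewrite /dot -big_split; apply: eq_bigr => j _; rewrite mxE mulrDl.
have dC (x y : 'rV[R]_n) : dot x y = dot y x.
  by apply: eq_bigr => j _; rewrite mulrC.
have dZ a (x y : 'rV[R]_n) : dot (a *: x) y = a * dot x y.
  by rewrite /dot big_distrr /=; apply: eq_bigr => j _; rewrite mxE mulrA.
have dN (x y : 'rV[R]_n) : dot (- x) y = - dot x y.
  by rewrite -scaleN1r dZ mulN1r.
have dge (x : 'rV[R]_n) : 0 <= dot x x.
  by apply: sumr_ge0 => j _; rewrite -expr2 sqr_ge0.
apply/rowP => i; rewrite !mxE.
have e1 : dot (delta_mx 0 i : 'rV[R]_m) (delta_mx 0 i) = 1.
  rewrite /dot (bigD1 i) //= big1 => [|j ji]; first by rewrite mxE !eqxx mulr1 addr0.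
  by rewrite !mxE (negbTE ji) andbF mulr0.
pose K := J (delta_mx 0 i).
have KD x y : K (x + y) = K x + K y.
  by have := cliff_linear J (delta_mx 0 i) 1 x y; rewrite !scale1r.
have K0 : K 0 = 0 by apply: (addrI (K 0)); rewrite -KD !addr0.
have KZ a x : K (a *: x) = a *: K x.
  by have := cliff_linear J (delta_mx 0 i) a x 0; rewrite -/K K0 !addr0.
have nK x : dot (K x) (K x) = dot x x.
  have := cliff_norm J (delta_mx 0 i) x; rewrite -/K /enorm e1 sqrtr1 mul1r => e.
  by rewrite -(sqr_sqrtr (dge (K x))) e sqr_sqrtr.
have KK x : K (K x) = - x by rewrite /K cliff_sq e1 scaleN1r.
have KV : dot (K V) V = 0.
  have := nK (K V + V); rewrite KD KK !dD !(dC _ (_ + _)) !dD !dN.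
  rewrite !(dC _ (- V)) !dN (dC V (K V)) nK; lra.
by rewrite -/K KZ dZ KV mulr0.
Qed.

(** Points and tangent vectors of the half-space model, in [v (+) z (+) R]. *)

Definition pack (R : realType) (n m : nat) (V : 'rV[R]_n) (Z : 'rV[R]_m) (t : R)
  : 'rV[R]_(n + m + 1) := row_mx (row_mx V Z) t%:M.

Definition vpart (R : realType) (n m : nat) (x : 'rV[R]_(n + m + 1)) : 'rV[R]_n :=
  lsubmx (lsubmx x).
Definition zpart (R : realType) (n m : nat) (x : 'rV[R]_(n + m + 1)) : 'rV[R]_m :=
  rsubmx (lsubmx x).
Definition tpart (R : realType) (n m : nat) (x : 'rV[R]_(n + m + 1)) : R :=
  (rsubmx x) 0 0.

Definition half_space (R : realType) (n m : nat) : set 'rV[R]_(n + m + 1) :=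
  [set x | 0 < tpart x].

Definition left_transl (R : realType) (n m : nat) (J : clifford_module R n m)
    (p x : 'rV[R]_(n + m + 1)) : 'rV[R]_(n + m + 1) :=
  pack (vpart p + Num.sqrt (tpart p) *: vpart x)
       (zpart p + tpart p *: zpart x
        + (2^-1 * Num.sqrt (tpart p)) *: bracket J (vpart p) (vpart x))
       (tpart p * tpart x).

(** Inverse in the group [S], whose neutral element is [(0, 0, 1)]. *)
Definition group_inv (R : realType) (n m : nat) (p : 'rV[R]_(n + m + 1))
  : 'rV[R]_(n + m + 1) :=
  pack (- (Num.sqrt (tpart p))^-1 *: vpart p) (- (tpart p)^-1 *: zpart p)
       (tpart p)^-1.

Lemma left_translV (R : realType) (n m : nat) (J : clifford_module R n m)
    (p : 'rV[R]_(n + m + 1)) :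
  half_space p -> left_transl J (group_inv p) p = pack 0 0 1.
Proof.
rewrite /half_space /= => p0.
have E (V : 'rV[R]_n) (Z : 'rV[R]_m) t :
    [/\ vpart (pack V Z t) = V, zpart (pack V Z t) = Z & tpart (pack V Z t) = t].
  by rewrite /vpart /zpart /tpart /pack !(row_mxKl, row_mxKr) !mxE /= mulr1n.
have s0 : Num.sqrt (tpart p) != 0 by rewrite gt_eqF // sqrtr_gt0.
rewrite /left_transl /group_inv.
case: (E (- (Num.sqrt (tpart p))^-1 *: vpart p) (- (tpart p)^-1 *: zpart p)
  (tpart p)^-1) => -> -> ->.
rewrite bracketZ sqrtrV ?ltW // scaler0 addr0.
by rewrite !scaleNr !addNr mulVf ?gt_eqF.
Qed.

(** Left-invariant metric: [<X, Y>_p = <d(L_(p^-1)) X, d(L_(p^-1)) Y>]. *)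
Definition dr_metric (R : realType) (n m : nat) (J : clifford_module R n m)
    (p : 'rV[R]_(n + m + 1)) : 'M[R]_(n + m + 1) :=
  \matrix_(i, j) dot ('D_(delta_mx 0 i) (left_transl J (group_inv p)) p)
                     ('D_(delta_mx 0 j) (left_transl J (group_inv p)) p).

Definition chi (R : realType) (m : nat) (z : 'rV[R]_m) (s x : R) : R :=
  (1 - s * x) ^+ 2 + enorm z ^+ 2 * x ^+ 2.

Definition geodesic_curve (R : realType) (n m : nat) (J : clifford_module R n m)
    (v : 'rV[R]_n) (z : 'rV[R]_m) (s x : R) : 'rV[R]_(n + m + 1) :=
  pack ((2 * x * (1 - s * x) / chi z s x) *: v
        + (2 * x ^+ 2 / chi z s x) *: J z v)
       ((2 * x / chi z s x) *: z)
       ((1 - x ^+ 2) / chi z s x).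

(** [RP^1] is the one-point compactification of [R]. The curve is affine
    off the zeros of [chi]. *)
Definition prolongation (R : realType) (n m : nat) (J : clifford_module R n m)
    (v : 'rV[R]_n) (z : 'rV[R]_m) (s : R)
    (gam : one_point_compactification R -> 'M[R]_(n + m + 1 + 1)) : Prop :=
  continuous gam /\
  forall x : R, chi z s x != 0 ->
    gam (Some x) = affine_point (geodesic_curve J v z s x).

Definition Dstar (R : realType) (n m : nat) (J : clifford_module R n m)
    (Vb : 'rV[R]_n) (tb : R) (v : 'rV[R]_n) (s : R) (x : 'rV[R]_(n + m + 1)) : R :=
  (tpart x)^-1 * ((2 * s * Num.sqrt tb - dot (vpart x - Vb) v) ^+ 2
                  + enorm (bracket J (vpart x - Vb) v) ^+ 2).

Definition Fstar (R : realType) (n m : nat) (J : clifford_module R n m)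
    (Vb : 'rV[R]_n) (tb : R) (v : 'rV[R]_n) (s : R) : set 'rV[R]_(n + m + 1) :=
  [set x | [/\ half_space x, bracket J (vpart x - Vb) v = 0 &
               dot (vpart x - Vb) v = 2 * s * Num.sqrt tb]].

(** [({u | [v, u] = 0} /\ v^perp) (+) z (+) R] *)
Definition focal_direction (R : realType) (n m : nat) (J : clifford_module R n m)
    (v : 'rV[R]_n) : set 'rV[R]_(n + m + 1) :=
  [set x | bracket J v (vpart x) = 0 /\ dot (vpart x) v = 0].

(* Main.v *)
Require Import Defs.
From mathcomp Require Import all_boot all_order all_algebra.
From mathcomp Require Import all_classical all_reals all_analysis.
From mathcomp Require Import ring lra.

(** Write [p = (V, Z, t)] and [D = N(V) / t] with
    [N(V) = (c - <V - Vb, v>)^2 + |[V - Vb, v]|^2] and [c = 2 s sqrt tb].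

    The differential of the left translation by [p^-1] sends [(U, W, tau)] to
    [(U / sqrt t, (W - [V, U] / 2) / t, tau / t)]; in this trivialization the
    metric is the Euclidean one, so its volume density is a power of [t] and
    [grad D = (grad N, [V, grad N] / 2, - N)]. The Clifford identities
    [|J_Z v| = |Z| |v|] and [J_Z v _|_ v] turn the quadratic function [N] into
    one with [|grad N|^2 = 4 |v|^2 N] and constant Euclidean Laplacian
    [2 (m + 1) |v|^2]. Hence [|grad D|^2 = 4 |v|^2 D + D^2]
    ([norm_grad_Dquot]) and
    [Laplacian D = 2 (m + 1) |v|^2 + (n / 2 + m + 1) D] ([laplacian_Dquot]),
    so [D] is isoparametric. As [D >= 0], the first formula also shows that the
    critical points of [D] are exactly its zeros ([critical_Dquot]): there are
    none when [v = 0], and they form the only focal variety otherwise. The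
    missing extremal values are excluded by letting [t] tend to [0] and, when
    [v = 0], to infinity.

    The focal variety is the part of an affine space [a + K] above the boundary,
    where [K] contains [z] and [R]. Left-trivialized, its tangent space contains
    [z], hence splits orthogonally into a subspace of [v], all of [z], and [a].
    The second fundamental form pairs only the first factor with the second
    ([koszul_normal]), so its trace vanishes ([gram_trace0],
    [minimal_affine]).

    In homogeneous coordinates the prolonged geodesic is polynomial in the
    point [p : q] of the projective line ([prolongation_range]); the continuity
    of the prolongation fixes its value at the poles and at infinity. After the
    projective map, the formula is that of a parabola in the parameters
    [(x, y)] obtained from [(p, q)] by an invertible linear change that
    completes the square, or of a line when [v = 0]. A parabola is not a line
    ([parabola_not_line]), which gives the two equivalences.

    For the horospheres, a curve has length at least the variation of [ln t]
    ([curve_length_ge]), with equality for vertical segments, and the horizontal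
    segment that joins [(V, Z, T)] to [(0, 0, T)] has a length that tends to [0]
    as [T] tends to infinity. So [x |-> (0, 0, exp x)] is a geodesic ray and its
    Busemann function is [- ln t] ([busemann_vertical]). *)

Import Order.TTheory GRing.Theory Num.Theory.
Import numFieldNormedType.Exports.

Local Open Scope classical_set_scope.
Local Open Scope ring_scope.

(** * Euclidean and Clifford algebra *)

Section Dot.
Context {R : realType} {k : nat}.
Implicit Types (x y z : 'rV[R]_k) (a : R).

Lemma dotC x y : dot x y = dot y x.
Proof. by apply: eq_bigr => i _; rewrite mulrC. Qed.

Lemma dotDl x y z : dot (x + y) z = dot x z + dot y z.
Proof. by rewrite /dot -big_split; apply: eq_bigr => i _; rewrite mxE mulrDl. Qed.

Lemma dotZl a x y : dot (a *: x) y = a * dot x y.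
Proof. by rewrite /dot big_distrr /=; apply: eq_bigr => i _; rewrite mxE mulrA. Qed.

Lemma dotDr x y z : dot x (y + z) = dot x y + dot x z.
Proof. by rewrite dotC dotDl !(dotC x). Qed.

Lemma dotZr a x y : dot x (a *: y) = a * dot x y.
Proof. by rewrite dotC dotZl (dotC x). Qed.

Lemma dotNl x y : dot (- x) y = - dot x y.
Proof. by rewrite -scaleN1r dotZl mulN1r. Qed.

Lemma dotNr x y : dot x (- y) = - dot x y.
Proof. by rewrite dotC dotNl dotC. Qed.

Lemma dot0l x : dot 0 x = 0.
Proof. by rewrite -(scale0r 0) dotZl mul0r. Qed.

Lemma dot0r x : dot x 0 = 0.
Proof. by rewrite dotC dot0l. Qed.

Definition dotE := (dotDl, dotDr, dotNl, dotNr, dotZl, dotZr, dot0l, dot0r).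

Lemma dot_ge0 x : 0 <= dot x x.
Proof. by apply: sumr_ge0 => i _; rewrite -expr2 sqr_ge0. Qed.

Lemma dot_eq0 x : (dot x x == 0) = (x == 0).
Proof.
apply/eqP/eqP => [h|->]; last by rewrite dot0l.
apply/rowP => i; rewrite mxE; apply/eqP; rewrite -sqrf_eq0; apply/eqP.
have := psumr_eq0P _ h => /(_ _ i isT); rewrite -expr2; apply => j _.
by rewrite -expr2 sqr_ge0.
Qed.

Lemma sqr_enorm x : enorm x ^+ 2 = dot x x.
Proof. by rewrite /enorm sqr_sqrtr ?dot_ge0. Qed.

Lemma dot_deltal i x : dot (delta_mx 0 i) x = x 0 i.
Proof.
rewrite /dot (bigD1 i) //= big1 ?addr0 => [|j ji].
  by rewrite mxE !eqxx mul1r.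
by rewrite mxE (negbTE ji) andbF mul0r.
Qed.

Lemma dot_deltar x i : dot x (delta_mx 0 i) = x 0 i.
Proof. by rewrite dotC dot_deltal. Qed.

Lemma dot_mulmxT x y : dot x y = (x *m y^T) 0 0.
Proof. by rewrite !mxE; apply: eq_bigr => i _; rewrite mxE. Qed.

Lemma dot_ext x y : (forall z, dot x z = dot y z) -> x = y.
Proof. by move=> h; apply/rowP => i; rewrite -!dot_deltar h. Qed.

End Dot.

Lemma dot_tr {R : realType} {k l : nat} (x : 'rV[R]_k) (y : 'rV[R]_l)
  (A : 'M[R]_(k, l)) : dot (x *m A) y = dot x (y *m A^T).
Proof. by rewrite !dot_mulmxT trmx_mul trmxK mulmxA. Qed.

Section Clifford.
Context {R : realType} {n m : nat} (J : clifford_module R n m).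
Implicit Types (U V W : 'rV[R]_n) (Z Y : 'rV[R]_m) (a : R).

Lemma cliffD Z U V : J Z (U + V) = J Z U + J Z V.
Proof. by have := cliff_linear J Z 1 U V; rewrite !scale1r. Qed.

Lemma cliff0 Z : J Z 0 = 0.
Proof. by apply: (addrI (J Z 0)); rewrite -cliffD !addr0. Qed.

Lemma cliffZ Z a U : J Z (a *: U) = a *: J Z U.
Proof. by have := cliff_linear J Z a U 0; rewrite cliff0 !addr0. Qed.

Lemma cliffDl Z Y U : J (Z + Y) U = J Z U + J Y U.
Proof. by have := cliff_linear_l J U 1 Z Y; rewrite !scale1r. Qed.

Lemma cliff0l U : J 0 U = 0.
Proof. by apply: (addrI (J 0 U)); rewrite -cliffDl !addr0. Qed.

Lemma cliffZl a Z U : J (a *: Z) U = a *: J Z U.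
Proof. by have := cliff_linear_l J U a Z 0; rewrite cliff0l !addr0. Qed.

Lemma dot_cliff Z U : dot (J Z U) (J Z U) = dot Z Z * dot U U.
Proof. by rewrite -!sqr_enorm cliff_norm exprMn. Qed.

(** Polarization of [dot_cliff] in the central variable: for [v <> 0] the map
    [Z |-> J Z v] is a similarity with ratio [|v|]. *)
Lemma dot_cliff2 Z Y U : dot (J Z U) (J Y U) = dot Z Y * dot U U.
Proof.
have := dot_cliff (Z + Y) U; rewrite cliffDl !dotE !dot_cliff.
by rewrite (dotC (J Y U)) (dotC Y Z); lra.
Qed.

Lemma bracketDl U V W : bracket J (U + V) W = bracket J U W + bracket J V W.
Proof. by apply/rowP => i; rewrite !mxE cliffD dotDl. Qed.

Lemma bracketZl a U W : bracket J (a *: U) W = a *: bracket J U W.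
Proof. by apply/rowP => i; rewrite !mxE cliffZ dotZl. Qed.

Lemma bracketDr U V W : bracket J W (U + V) = bracket J W U + bracket J W V.
Proof. by apply/rowP => i; rewrite !mxE dotDr. Qed.

Lemma bracketZr a U W : bracket J W (a *: U) = a *: bracket J W U.
Proof. by apply/rowP => i; rewrite !mxE dotZr. Qed.

Lemma bracketNl U W : bracket J (- U) W = - bracket J U W.
Proof. by rewrite -scaleN1r bracketZl scaleN1r. Qed.

Lemma bracketNr U W : bracket J W (- U) = - bracket J W U.
Proof. by rewrite -scaleN1r bracketZr scaleN1r. Qed.

Lemma bracket0l U : bracket J 0 U = 0.
Proof. by rewrite -(scale0r 0) bracketZl scale0r. Qed.

Lemma bracket0r U : bracket J U 0 = 0.
Proof. by rewrite -(scale0r 0) bracketZr scale0r. Qed.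

Lemma bracketxx U : bracket J U U = 0.
Proof. by rewrite -[U in bracket J U]scale1r bracketZ. Qed.

Lemma bracketC U V : bracket J U V = - bracket J V U.
Proof.
have := bracketxx (U + V); rewrite bracketDl !bracketDr !bracketxx addr0 add0r.
by move/eqP; rewrite addr_eq0 => /eqP.
Qed.

Lemma cliff_skew Z U V : dot (J Z U) V = - dot U (J Z V).
Proof. by rewrite -bracketP bracketC dotNl bracketP dotC. Qed.

Lemma cliff_perp Z U : dot (J Z U) U = 0.
Proof. by rewrite -bracketP bracketxx dot0l. Qed.

End Clifford.

(** * Coordinates of the half-space model *)

Section Pack.
Context {R : realType} {n m : nat}.
Local Notation N := (n + m + 1)%N.
Implicit Types (V : 'rV[R]_n) (Z : 'rV[R]_m) (t a : R) (x y : 'rV[R]_N).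

Lemma vpart_pack V Z t : vpart (pack V Z t) = V.
Proof. by rewrite /vpart /pack !row_mxKl. Qed.

Lemma zpart_pack V Z t : zpart (pack V Z t) = Z.
Proof. by rewrite /zpart /pack row_mxKl row_mxKr. Qed.

Lemma tpart_pack V Z t : tpart (pack V Z t) = t.
Proof. by rewrite /tpart /pack row_mxKr mxE mulr1n. Qed.

Definition packE := (vpart_pack, zpart_pack, tpart_pack).

Lemma pack_parts x : pack (vpart x) (zpart x) (tpart x) = x.
Proof.
rewrite /pack /vpart /zpart /tpart hsubmxK -[RHS]hsubmxK; congr (row_mx _ _).
by apply/rowP => i; rewrite ord1 !mxE mulr1n.
Qed.

Lemma packD V Z t V' Z' t' :
  pack V Z t + pack V' Z' t' = pack (V + V') (Z + Z') (t + t').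
Proof. by rewrite /pack !add_row_mx raddfD. Qed.

Lemma packZ a V Z t : a *: pack V Z t = pack (a *: V) (a *: Z) (a * t).
Proof. by rewrite /pack !scale_row_mx scale_scalar_mx. Qed.

Lemma packN V Z t : - pack V Z t = pack (- V) (- Z) (- t).
Proof. by rewrite -scaleN1r packZ !scaleN1r mulN1r. Qed.

Lemma pack0 : pack 0 0 0 = 0 :> 'rV[R]_N.
Proof. by rewrite -(scale0r (pack 0 0 0)) packZ !scaler0 mul0r. Qed.

Lemma vpartD x y : vpart (x + y) = vpart x + vpart y.
Proof. by rewrite /vpart !linearD. Qed.
Lemma zpartD x y : zpart (x + y) = zpart x + zpart y.
Proof. by rewrite /zpart !linearD. Qed.
Lemma tpartD x y : tpart (x + y) = tpart x + tpart y.
Proof. by rewrite /tpart linearD mxE. Qed.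
Lemma vpartZ a x : vpart (a *: x) = a *: vpart x.
Proof. by rewrite /vpart !linearZ. Qed.
Lemma zpartZ a x : zpart (a *: x) = a *: zpart x.
Proof. by rewrite /zpart !linearZ. Qed.
Lemma tpartZ a x : tpart (a *: x) = a * tpart x.
Proof. by rewrite /tpart linearZ mxE. Qed.

Definition partE := (vpartD, zpartD, tpartD, vpartZ, zpartZ, tpartZ, packE).

Lemma dot_pack V Z t V' Z' t' :
  dot (pack V Z t) (pack V' Z' t') = dot V V' + dot Z Z' + t * t'.
Proof.
rewrite !dot_mulmxT /pack !tr_row_mx !mul_row_col tr_scalar_mx -scalar_mxM.
by rewrite [LHS]mxE [X in X + _]mxE [X in _ + X]mxE mulr1n.
Qed.

Lemma dot_parts x y :
  dot x y = dot (vpart x) (vpart y) + dot (zpart x) (zpart y) + tpart x * tpart y.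
Proof. by rewrite -{1}(pack_parts x) -{1}(pack_parts y) dot_pack. Qed.

End Pack.

(** * Derivatives along lines and smoothness *)

(** Reduces every directional derivative below to a derivative of a function of
    one real variable. *)
Lemma is_derive_line {R : realType} {V W : normedModType R} (f : V -> W) x v df :
  is_derive (0 : R) 1 (fun h => f (h *: v + x)) df -> is_derive x v f df.
Proof.
move=> [d e]; apply: DeriveDef; first exact/derivable1P.
rewrite -e /derive.
set g1 := fun h => _; set g2 := fun h => _; suff -> : g1 = g2 by [].
by rewrite funeqE /g1 /g2 => h /=; rewrite addr0 scale0r add0r [_%:A]mulr1.
Qed.

Lemma is_derive_affine {R : realType} {V W : normedModType R} (f : V -> W) x v df :
  (forall h : R, f (h *: v + x) = f x + h *: df) -> is_derive x v f df.
Proof.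
move=> hf; apply: is_derive_line.
under eq_fun do rewrite hf.
suff H : is_derive (0 : R) 1 (fun h : R => h *: df) df.
  have H0 : is_derive (0 : R) 1 (cst (f x)) 0 by exact: is_derive_cst.
  by have := is_deriveD H0 H; rewrite add0r.
apply: DeriveDef.
  by apply: diff_derivable; apply: differentiableZl.
apply/cvg_lim => //; apply: cvg_near_cst; near=> h.
have h0 : h != 0 by near: h; exact: nbhs_dnbhs_neq.
by rewrite /= addr0 scale0r subr0 [_%:A]mulr1 scalerA mulVf ?scale1r.
Unshelve. all: by end_near. Qed.

Lemma derive_is {R : realType} {V W : normedModType R} (f : V -> W) x v df :
  is_derive x v f df -> 'D_v f x = df.
Proof. by case. Qed.

(** Differentiability is local; the remainder estimate at [x] only sees a
    neighbourhood of [x]. *)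
Lemma near_eq_differentiable {R : realType} {V W : normedModType R}
  (f g : V -> W) x : (\near x, f x = g x) -> differentiable f x -> differentiable g x.
Proof.
move=> fg /diff_locallyP [df fE].
have gE : g \o shift x = cst (g x) + 'd f x +o_ (0 : V) id.
  apply/eqaddoP => _/posnumP[e].
  have /eqaddoP /(_ e%:num) /(_ [gt0 of e%:num]) := fE.
  apply: filter_app.
  have : \forall y \near (0 : V), f (y + x) = g (y + x).
    by move: fg; rewrite (near_shift 0) subr0.
  apply: filter_app; near=> y => /= fgy.
  by rewrite /= !fctE /= fgy (nbhs_singleton fg).
have dg : 'd g x = 'd f x :> (V -> W) by apply: diff_unique.
by apply/diff_locallyP; rewrite dg.
Unshelve. all: by end_near. Qed.

(** Smoothness from a class of differentiable functions that directional
    derivatives map to itself. The derivatives need only be represented on [U],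
    as [U] is open. *)
Lemma smooth_on_class {R : realType} {V W : normedModType R} (U : set V)
    (C : set (V -> W)) :
  open U ->
  (forall f x, C f -> U x -> differentiable f x) ->
  (forall f v, C f -> exists2 g, C g & forall x, U x -> 'D_v f x = g x) ->
  forall f, C f -> smooth_on U f.
Proof.
move=> oU Cdiff CD f Cf vs.
suff [g Cg gE] : exists2 g, C g &
    forall x, U x -> foldr (fun v (g : V -> W) y => 'D_v g y) f vs x = g x.
  move=> x Ux; apply: (@near_eq_differentiable _ _ _ g); last exact: Cdiff.
  have : nbhs x U by apply: open_nbhs_nbhs.
  by apply: filterS => y /gE.
elim: vs => [|v vs [g Cg gE]] /=; first by exists f.
have [g' Cg' g'E] := CD g v Cg.
exists g' => // x Ux; rewrite -g'E //; apply: near_eq_derive.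
have : nbhs x U by apply: open_nbhs_nbhs.
by apply: filterS => y /gE.
Qed.

Section HalfSpace.
Context {R : realType} {n m : nat}.
Local Notation N := (n + m + 1)%N.

Lemma tpart_coord (x : 'rV[R]_N) : tpart x = x 0 (rshift (n + m) 0).
Proof. by rewrite /tpart mxE. Qed.

Lemma vpart_coord (x : 'rV[R]_N) i : vpart x 0 i = x 0 (lshift 1 (lshift m i)).
Proof. by rewrite /vpart !mxE. Qed.

Lemma tpart_coordE : @tpart R n m = fun x => x 0 (rshift (n + m) 0).
Proof. by apply/funext => x; exact: tpart_coord. Qed.

Lemma continuous_tpart : continuous (@tpart R n m).
Proof. by rewrite tpart_coordE; exact: coord_continuous. Qed.

Lemma open_half_space : open (@half_space R n m).
Proof.
rewrite (_ : @half_space R n m = @tpart R n m @^-1` [set t | 0 < t]) //.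
by apply: open_comp; [move=> x _; exact: continuous_tpart | exact: open_gt].
Qed.

(** Polynomials in the coordinates and in [1 / t]; closed under derivation. *)
Inductive laurent_t : ('rV[R]_N -> R) -> Prop :=
| LaurentCst a : laurent_t (cst a)
| LaurentCoord i : laurent_t (fun x => x 0 i)
| LaurentInv : laurent_t (fun x => (tpart x)^-1)
| LaurentAdd f g : laurent_t f -> laurent_t g -> laurent_t (f + g)
| LaurentMul f g : laurent_t f -> laurent_t g -> laurent_t (f * g).

Lemma is_derive_coord (x v : 'rV[R]_N) i :
  is_derive x v (fun y : 'rV[R]_N => y 0 i : R) (v 0 i).
Proof. by apply: is_derive_affine => h; rewrite !mxE addrC. Qed.

Lemma is_derive_tpart (x v : 'rV[R]_N) : is_derive x v (@tpart R n m) (tpart v).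
Proof. by apply: is_derive_affine => h; rewrite tpartD tpartZ addrC. Qed.

Lemma is_derive_tpartV (x v : 'rV[R]_N) : half_space x ->
  is_derive x v (fun y : 'rV[R]_N => (tpart y)^-1)
    (- (tpart v * (tpart x)^-1 * (tpart x)^-1)).
Proof.
move=> x0; have [d dE] := is_derive_tpart x v.
have tx : tpart x != 0 by rewrite gt_eqF.
split; first exact: derivableV.
rewrite (deriveV tx d) dE -exprVn expr2 scaleNr; congr (- _).
by rewrite [LHS]mulrC mulrA.
Qed.

Lemma laurent_t_differentiable f (x : 'rV[R]_N) :
  laurent_t f -> half_space x -> differentiable f x.
Proof.
move=> Cf Ux; elim: Cf => [a|i||g h _ dg _ dh|g h _ dg _ dh].
- exact: differentiable_cst.
- exact: differentiable_coord.
- apply: differentiableV; last by rewrite gt_eqF.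
  by rewrite tpart_coordE; exact: differentiable_coord.
- exact: differentiableD.
- exact: differentiableM.
Qed.

Lemma laurent_t_derive f (v : 'rV[R]_N) : laurent_t f ->
  exists2 g, laurent_t g & forall x, half_space x -> is_derive x v f (g x).
Proof.
elim=> [a|i||g h Cg [g' Cg' dg] Ch [h' Ch' dh]|g h Cg [g' Cg' dg] Ch [h' Ch' dh]].
- by exists (cst 0) => [|x _]; [exact: LaurentCst | exact: is_derive_cst].
- by exists (cst (v 0 i)) => [|x _]; [exact: LaurentCst | exact: is_derive_coord].
- exists (cst (- tpart v) * (fun x => (tpart x)^-1) * (fun x => (tpart x)^-1)).
    by do 2?apply: LaurentMul; [exact: LaurentCst | exact: LaurentInv ..].
  by move=> x x0; have := is_derive_tpartV x v x0; rewrite !fctE !mulNr.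
- exists (g' + h') => [|x x0]; first exact: LaurentAdd.
  by have := is_deriveD (dg x x0) (dh x x0).
- exists (g * h' + h * g') => [|x x0].
    by apply: LaurentAdd; apply: LaurentMul.
  by have := is_deriveM (dg x x0) (dh x x0).
Qed.

Lemma laurent_t_smooth f : laurent_t f -> smooth_on (@half_space R n m) f.
Proof.
apply: smooth_on_class; first exact: open_half_space.
  by move=> g x; exact: laurent_t_differentiable.
move=> g v Cg; have [g' Cg' dg] := laurent_t_derive g v Cg.
by exists g' => // x Ux; have [] := dg x Ux.
Qed.

Lemma laurent_t_sum k (F : 'I_k -> 'rV[R]_N -> R) :
  (forall i, laurent_t (F i)) -> laurent_t (fun x => \sum_i F i x).
Proof.
move=> CF; rewrite (_ : (fun _ => _) = \sum_i F i); last first.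
  by apply/funext => x; rewrite fct_sumE.
by apply: big_ind; [exact: (LaurentCst 0) | exact: LaurentAdd | ].
Qed.

Lemma laurent_t_dot_vpart (U w : 'rV[R]_n) :
  laurent_t (fun x => dot (vpart x - U) w).
Proof.
apply: laurent_t_sum => i; apply: (LaurentMul _ (cst _)); last exact: LaurentCst.
rewrite (_ : (fun _ => _) =
  (fun x : 'rV[R]_N => x 0 (lshift 1 (lshift m i))) + cst (- U 0 i)).
  by apply: LaurentAdd; [exact: LaurentCoord | exact: LaurentCst].
by apply/funext => x; rewrite !mxE.
Qed.

End HalfSpace.

(** The class consists of all affine maps: a directional derivative of an affine
    map is constant, hence again affine. *)
Lemma affine_smooth {R : realType} {k l : nat} (a : 'rV[R]_l) (P : 'M[R]_(k, l))
  (O : set 'rV[R]_k) : open O -> smooth_on O (fun y => a + y *m P).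
Proof.
move=> oO; have D (b : 'rV[R]_l) (Q : 'M[R]_(k, l)) y v :
    'D_v (fun y : 'rV[R]_k => b + y *m Q) y = v *m Q.
  apply: derive_is; apply: is_derive_affine => h.
  by rewrite mulmxDl -scalemxAl addrCA addrC.
apply: (smooth_on_class _ [set f | exists b Q, f = fun y => b + y *m Q]) => //.
- move=> f y [b [Q ->]] _.
  apply: (@differentiableD _ _ _ (cst b) (mulmxr Q)).
    exact: differentiable_cst.
  rewrite (_ : mulmxr Q = \sum_(i < k) (fun y : 'rV[R]_k => y 0 i *: row i Q)).
    apply: differentiable_sum => i.
    by apply: differentiableZl; exact: differentiable_coord.
  by apply/funext => z; rewrite /= fct_sumE mulmx_sum_row.
- move=> f v [b [Q ->]]; exists (fun y => v *m Q + y *m 0).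
    by exists (v *m Q), 0.
  by move=> y _; rewrite D mulmx0 addr0.
by exists a, P.
Qed.

Lemma mul_rV_rows {R : realType} {k l : nat} (f : 'rV[R]_k -> 'rV[R]_l) x :
  linear f -> x *m (\matrix_(i < k) f (delta_mx 0 i)) = f x.
Proof.
move=> lf.
have f0 : f 0 = 0 by have := lf (-1) 0 0; rewrite scaler0 add0r scaleN1r addNr.
rewrite mulmx_sum_row [in RHS](row_sum_delta x).
elim/big_rec2: _ => [|i y1 y2 _ e]; first by rewrite f0.
by rewrite lf rowK e.
Qed.

(** * The left-invariant metric *)

Section Metric.
Context {R : realType} {n m : nat} (J : clifford_module R n m).
Local Notation N := (n + m + 1)%N.
Implicit Types p x y X Y : 'rV[R]_N.

(** Left-trivialization of the tangent vector [X] at [p]. *)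
Definition trivialize p X : 'rV[R]_N :=
  pack ((Num.sqrt (tpart p))^-1 *: vpart X)
       ((tpart p)^-1 *: (zpart X - 2^-1 *: bracket J (vpart p) (vpart X)))
       ((tpart p)^-1 * tpart X).

Lemma trivialize_linear p : linear (trivialize p).
Proof.
move=> a X Y; rewrite /trivialize packZ packD !partE; congr (pack _ _ _).
- by rewrite scalerDr !scalerA mulrC.
- rewrite bracketDr bracketZr.
  move: (bracket _ _ (vpart X)) (bracket _ _ (vpart Y)) => b1 b2.
  by apply/rowP => j; rewrite !mxE; ring.
- by ring.
Qed.

Lemma is_derive_left_transl p X : half_space p ->
  is_derive p X (left_transl J (group_inv p)) (trivialize p X).
Proof.
move=> p0; apply: is_derive_affine => h.
have rE : Num.sqrt (tpart p)^-1 = (Num.sqrt (tpart p))^-1 by rewrite sqrtrV ?ltW.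
have tE : (tpart p)^-1 = (Num.sqrt (tpart p))^-1 * (Num.sqrt (tpart p))^-1.
  by rewrite -expr2 exprVn sqr_sqrtr ?ltW.
rewrite /left_transl /group_inv /trivialize !packE packZ packD !partE rE.
congr (pack _ _ _).
- by rewrite scalerDr addrCA addrC !scalerA mulrC.
- rewrite bracketDr !bracketZr !bracketZl tE.
  move: (bracket _ _ (vpart X)) (bracket _ _ (vpart p)) => b1 b2.
  by apply/rowP => j; rewrite !mxE; ring.
- by ring.
Qed.

Definition triv_mx p : 'M[R]_N := \matrix_(i < N) trivialize p (delta_mx 0 i).

Lemma mul_triv_mx p X : X *m triv_mx p = trivialize p X.
Proof. exact: mul_rV_rows (trivialize_linear p). Qed.

(** The metric is the pull-back of the Euclidean one by [trivialize p], which
    makes its inverse and its determinant accessible through [triv_mx]. *)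
Lemma dr_metricE p : half_space p -> dr_metric J p = triv_mx p *m (triv_mx p)^T.
Proof.
move=> p0; apply/matrixP => i j; rewrite !mxE.
rewrite !(derive_is _ _ _ _ (is_derive_left_transl _ _ p0)).
by apply: eq_bigr => l _; rewrite !mxE.
Qed.

Lemma innerE p X Y : half_space p ->
  inner (dr_metric J) p X Y = dot (trivialize p X) (trivialize p Y).
Proof.
move=> p0; rewrite /inner dr_metricE // mulmxA mul_triv_mx.
by rewrite -mulmxA -trmx_mul mul_triv_mx dot_mulmxT.
Qed.

Lemma dot_trivialize p X Y : half_space p ->
  dot (trivialize p X) (trivialize p Y) =
    (tpart p)^-1 * dot (vpart X) (vpart Y) +
    (tpart p)^-2 * (dot (zpart X - 2^-1 *: bracket J (vpart p) (vpart X))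
                        (zpart Y - 2^-1 *: bracket J (vpart p) (vpart Y))
                    + tpart X * tpart Y).
Proof.
move=> p0; have t0 : tpart p != 0 by rewrite gt_eqF.
rewrite dot_pack !(dotZl (_^-1)) !(dotZr (_^-1)) (mulrA (Num.sqrt _)^-1) -invfM -expr2 sqr_sqrtr ?ltW //.
by rewrite -exprVn; ring.
Qed.

(** [triv_mx p] is block triangular, with scalar diagonal blocks. *)
Lemma det_triv_mx p : half_space p ->
  \det (triv_mx p) = (Num.sqrt (tpart p))^-1 ^+ (n + 2 * m + 2).
Proof.
move=> p0; set r := (Num.sqrt _)^-1.
have tE : (tpart p)^-1 = r ^+ 2 by rewrite exprVn sqr_sqrtr ?ltW.
pose A : 'M[R]_(n, m) :=
  \matrix_(i < n) (- (2^-1 * r ^+ 2) *: bracket J (vpart p) (delta_mx 0 i)).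
have -> : triv_mx p =
    block_mx (block_mx r%:M A 0 (r ^+ 2)%:M) 0 0 (r ^+ 2)%:M.
  apply/row_matrixP => i; rewrite !rowE mul_triv_mx; move: (delta_mx 0 i) => X.
  rewrite -[X in RHS](pack_parts X) /pack !mul_row_block !mulmx0 !addr0 add0r.
  rewrite /trivialize /pack -/r tE; congr (row_mx (row_mx _ _) _).
  - by rewrite mul_mx_scalar.
  - rewrite (@mul_rV_rows _ _ _ (fun U => - (2^-1 * r ^+ 2) *: bracket J (vpart p) U)).
      rewrite mul_mx_scalar scalerBr scalerA mulrC addrC; congr (_ + _).
      by rewrite scaleNr mulrC.
    move=> a U V; rewrite bracketDr bracketZr scalerDr !scalerA.
    by congr (_ *: _ + _); rewrite mulrC.
  - by rewrite -scalar_mxM mulrC.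
rewrite !det_ublock !det_scalar expr1 -!exprM -!exprD; congr (_ ^+ _).
Qed.

Lemma triv_mx_unit p : half_space p -> triv_mx p \in unitmx.
Proof.
move=> p0; rewrite unitmxE det_triv_mx // unitfE expf_neq0 // invr_eq0.
by rewrite gt_eqF // sqrtr_gt0.
Qed.

Lemma dr_metric_unit p : half_space p -> dr_metric J p \in unitmx.
Proof.
by move=> p0; rewrite dr_metricE // unitmx_mul unitmx_tr triv_mx_unit.
Qed.

Lemma sqrt_det_metric p : half_space p ->
  Num.sqrt (\det (dr_metric J p)) = (Num.sqrt (tpart p))^-1 ^+ (n + 2 * m + 2).
Proof.
move=> p0; rewrite dr_metricE // det_mulmx det_tr -expr2 sqrtr_sqr.
rewrite det_triv_mx // ger0_norm // exprn_ge0 // invr_ge0 sqrtr_ge0 //.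
Qed.

Lemma inner_eq0 p X : half_space p -> inner (dr_metric J) p X X = 0 -> X = 0.
Proof.
move=> p0; rewrite innerE // => /eqP; rewrite dot_eq0 -mul_triv_mx => /eqP h.
by rewrite -(mulmxK (triv_mx_unit p p0) X) h mul0mx.
Qed.

(** Characterization of the gradient by duality, which avoids the inverse of
    the Gram matrix. *)
Lemma grad_eq F p g : half_space p ->
  (forall X, is_derive p X F (dot (trivialize p g) (trivialize p X))) ->
  grad (dr_metric J) F p = g.
Proof.
move=> p0 dF; rewrite /grad -[RHS](mulmxK (dr_metric_unit p p0)); congr (_ *m _).
apply/rowP => i; rewrite mxE (derive_is _ _ _ _ (dF _)) -innerE // /inner.
by rewrite trmx_delta -colE mxE.
Qed.

End Metric.

(** * Gradient and Laplacian of the function *)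

Lemma is_derive_quadratic {R : realType} {V : normedModType R} (f : V -> R) x v a b :
  (forall h : R, f (h *: v + x) = f x + h * a + h ^+ 2 * b) -> is_derive x v f a.
Proof.
move=> hf; apply: is_derive_line; under eq_fun do rewrite hf.
have H : is_derive (0 : R) 1 (fun h : R => (a + h * b) * h + f x) a.
  apply: is_derive_eq.
  by rewrite /GRing.scale /=; ring.
by rewrite (_ : (fun _ => _) = fun h : R => (a + h * b) * h + f x) //;
  apply/funext => h; ring.
Qed.

Lemma is_derive_rsqrtX {R : realType} (k : nat) (t : R) : 0 < t ->
  is_derive t 1 (fun y : R => (Num.sqrt y)^-1 ^+ k)
    (- (k%:R / 2 * t^-1 * (Num.sqrt t)^-1 ^+ k)).
Proof.
move=> t0; have s0 : Num.sqrt t != 0 by rewrite gt_eqF // sqrtr_gt0.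
rewrite (_ : (fun y => _) = (fun y : R => (Num.sqrt y)^-1) ^+ k); last first.
  by apply/funext => y; rewrite exprfctE.
apply: is_derive_eq (is_deriveX k (is_deriveV s0 (is_derive1_sqrt t0))) _.
rewrite sqr_sqrtr ?ltW // /GRing.scale /=.
case: k => [|k]; first by rewrite !mul0r oppr0.
by rewrite /= exprS invfM; ring.
Qed.

Section Dfun.
Context {R : realType} {n m : nat} (J : clifford_module R n m).
Local Notation N := (n + m + 1)%N.
Implicit Types (p x y X Y : 'rV[R]_N) (U V : 'rV[R]_n).
Variables (Vb v : 'rV[R]_n) (c : R).

(** [c] plays the role of [2 s sqrt tb]. *)
Definition Dnum V : R :=
  (c - dot (V - Vb) v) ^+ 2 + dot (bracket J (V - Vb) v) (bracket J (V - Vb) v).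

Definition grad_Dnum V : 'rV[R]_n :=
  - (2 * (c - dot (V - Vb) v)) *: v - 2 *: J (bracket J (V - Vb) v) v.

Lemma Dnum_ge0 V : 0 <= Dnum V.
Proof. by rewrite addr_ge0 ?sqr_ge0 ?dot_ge0. Qed.

Lemma Dnum_eq0 V :
  Dnum V = 0 <-> bracket J (V - Vb) v = 0 /\ dot (V - Vb) v = c.
Proof.
split=> [/eqP|[h1 h2]]; last by rewrite /Dnum h1 h2 subrr expr0n dot0l addr0.
rewrite paddr_eq0 ?sqr_ge0 ?dot_ge0 // dot_eq0 sqrf_eq0 subr_eq0.
by case/andP => /eqP <- /eqP.
Qed.

Lemma Dnum_line V U h : Dnum (h *: U + V) =
  Dnum V + h * dot (grad_Dnum V) U
  + h ^+ 2 * (dot U v ^+ 2 + dot (bracket J U v) (bracket J U v)).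
Proof.
rewrite /Dnum /grad_Dnum -(addrA (h *: U)); move: (V - Vb) => W.
rewrite bracketDl bracketZl.
rewrite !dotE -bracketP (bracketC _ v U) dotNl.
rewrite (dotC v U) (dotC (bracket J W v) (bracket J U v)); ring.
Qed.

Lemma grad_Dnum_line V U h :
  grad_Dnum (h *: U + V) =
  grad_Dnum V + h *: (2 *: (dot U v *: v - J (bracket J U v) v)).
Proof.
rewrite /grad_Dnum -(addrA (h *: U)); move: (V - Vb) => W.
rewrite bracketDl bracketZl dotDl dotZl cliffDl cliffZl.
move: (J _ v) (J _ v) => j1 j2.
by apply/rowP => j; rewrite !mxE; ring.
Qed.

Lemma dot_grad_Dnum V :
  dot (grad_Dnum V) (grad_Dnum V) = 4 * dot v v * Dnum V.
Proof.
rewrite /grad_Dnum /Dnum; move: (V - Vb) => W.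
by rewrite !dotE dot_cliff (dotC v (J _ _)) cliff_perp; ring.
Qed.

(** The left-hand side is the squared Hilbert-Schmidt norm of [U |-> [U, v]],
    whose adjoint [Z |-> J Z v] is a similarity of ratio [|v|] on an
    [m]-dimensional space. *)
Lemma sum_sqr_bracket :
  \sum_(i < n) dot (bracket J (delta_mx 0 i) v) (bracket J (delta_mx 0 i) v)
  = m%:R * dot v v.
Proof.
rewrite exchange_big /= -[m in RHS]card_ord -sum1_card natr_sum big_distrl /=.
apply: eq_bigr => j _; rewrite mul1r.
have <- : dot (J (delta_mx 0 j) v) (J (delta_mx 0 j) v) = dot v v.
  by rewrite dot_cliff dot_deltal mxE !eqxx mul1r.
apply: eq_bigr => i _; rewrite !mxE cliff_skew dot_deltal.
by rewrite mulrNN.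
Qed.

Lemma laplacian_Dnum : \sum_(i < n)
   (2 *: (dot (delta_mx 0 i) v *: v - J (bracket J (delta_mx 0 i) v) v)) 0 i
  = 2 * (m%:R + 1) * dot v v.
Proof.
have E i : (2 *: (dot (delta_mx 0 i) v *: v - J (bracket J (delta_mx 0 i) v) v)) 0 i
  = 2 * (v 0 i * v 0 i)
    + 2 * dot (bracket J (delta_mx 0 i) v) (bracket J (delta_mx 0 i) v).
  rewrite -[LHS]dot_deltar !dotE -bracketP (bracketC _ v) dotNl !dot_deltal dot_deltar.
  by ring.
under eq_bigr do rewrite E.
by rewrite big_split /= -!big_distrr /= sum_sqr_bracket -/(dot v v); ring.
Qed.

Definition Dquot x : R := (tpart x)^-1 * Dnum (vpart x).

Lemma laurent_t_Dquot : laurent_t Dquot.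
Proof.
have B : laurent_t (fun x => c - dot (vpart x - Vb) v).
  rewrite (_ : (fun _ => _) = cst c + cst (-1) * (fun x => dot (vpart x - Vb) v)).
    apply: LaurentAdd; first exact: LaurentCst.
    by apply: LaurentMul; [exact: LaurentCst | exact: laurent_t_dot_vpart].
  by apply/funext => x; rewrite !fctE mulN1r.
apply: LaurentMul; first exact: LaurentInv.
apply: LaurentAdd; first by apply: LaurentMul.
apply: laurent_t_sum => j.
have C : laurent_t (fun x => bracket J (vpart x - Vb) v 0 j).
  rewrite (_ : (fun _ => _) =
      fun x => dot (vpart x - Vb) (- J (delta_mx 0 j) v)).
    exact: laurent_t_dot_vpart.
  by apply/funext => x; rewrite mxE cliff_skew dotNr.
by apply: LaurentMul.
Qed.

Lemma is_derive_Dnum x X :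
  is_derive x X (fun y => Dnum (vpart y)) (dot (grad_Dnum (vpart x)) (vpart X)).
Proof.
by apply: is_derive_quadratic => h; rewrite vpartD vpartZ Dnum_line.
Qed.

Definition grad_Dquot x : 'rV[R]_N :=
  let g := grad_Dnum (vpart x) in
  pack g (2^-1 *: bracket J (vpart x) g) (- Dnum (vpart x)).

(** The trivialization of [grad_Dquot p] has no central component, so it pairs
    with that of [X] to [<grad_Dnum, X_v> / t - num X_t / t^2]. *)
Lemma grad_DquotE p : half_space p -> grad (dr_metric J) Dquot p = grad_Dquot p.
Proof.
move=> p0; apply: grad_eq => // X.
have H1 := is_derive_tpartV p X p0.
apply: is_derive_eq (is_deriveM H1 (is_derive_Dnum p X)) _.
rewrite dot_trivialize // /grad_Dquot !packE subrr dot0l add0r.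
by rewrite -exprVn /GRing.scale /=; ring.
Qed.

Lemma norm_grad_Dquot p : half_space p ->
  inner (dr_metric J) p (grad (dr_metric J) Dquot p) (grad (dr_metric J) Dquot p)
  = 4 * dot v v * Dquot p + Dquot p ^+ 2.
Proof.
move=> p0; rewrite grad_DquotE // innerE // dot_trivialize // /grad_Dquot !packE.
by rewrite subrr dot0l dot_grad_Dnum /Dquot -exprVn; ring.
Qed.

(** The divergence form of the Laplacian: the volume density is a power of [t],
    so the [v]-components contribute the constant Euclidean Laplacian of the
    numerator, the [z]-components nothing, and the [t]-component a multiple of
    the function. *)
Lemma laplacian_Dquot p : half_space p ->
  laplacian (dr_metric J) Dquot p =
  2 * (m%:R + 1) * dot v v + (n%:R / 2 + m%:R + 1) * Dquot p.
Proof.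
move=> p0; set k := (n + 2 * m + 2)%N.
pose w (t : R) : R := (Num.sqrt t)^-1 ^+ k.
have D i : 'D_(delta_mx 0 i) (fun q => Num.sqrt (\det (dr_metric J q)) *
      grad (dr_metric J) Dquot q 0 i) p
    = 'D_(delta_mx 0 i) (fun q => w (tpart q) * grad_Dquot q 0 i) p.
  apply: near_eq_derive.
  have : nbhs p (@half_space R n m).
    by apply: open_nbhs_nbhs; split; [exact: open_half_space | ].
  by apply: filterS => q q0; rewrite sqrt_det_metric // grad_DquotE.
rewrite /laplacian; under eq_bigr do rewrite D.
rewrite big_split_ord big_split_ord /= big_ord1.
have dv i : delta_mx 0 (lshift 1 (lshift m i)) = pack (delta_mx 0 i) 0 0 :> 'rV[R]_N.
  apply: dot_ext => x; rewrite dot_deltal dot_parts !packE dot_deltal.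
  by rewrite dot0l mul0r !addr0 vpart_coord.
have dz i : delta_mx 0 (lshift 1 (rshift n i)) = pack 0 (delta_mx 0 i) 0 :> 'rV[R]_N.
  apply: dot_ext => x; rewrite dot_deltal dot_parts !packE dot_deltal.
  by rewrite dot0l mul0r addr0 add0r /zpart !mxE.
have dt : delta_mx 0 (rshift (n + m) 0) = pack 0 0 1 :> 'rV[R]_N.
  apply: dot_ext => x; rewrite dot_deltal dot_parts !packE !dot0l.
  by rewrite mul1r !add0r tpart_coord.
rewrite sqrt_det_metric // -/k -/(w (tpart p)).
have Dv i : 'D_(delta_mx 0 (lshift 1 (lshift m i)))
    (fun q => w (tpart q) * grad_Dquot q 0 (lshift 1 (lshift m i))) p =
    w (tpart p) *
    (2 *: (dot (delta_mx 0 i) v *: v - J (bracket J (delta_mx 0 i) v) v)) 0 i.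
  apply: derive_is; apply: is_derive_affine => h.
  rewrite dv -!vpart_coord !partE mulr0 add0r grad_Dnum_line.
  have E (x y : 'rV[R]_n) : (x + h *: y) 0 i = x 0 i + h * y 0 i by rewrite !mxE.
  by rewrite E mulrDr [h *: _]mulrCA.
have Dz i : 'D_(delta_mx 0 (lshift 1 (rshift n i)))
    (fun q => w (tpart q) * grad_Dquot q 0 (lshift 1 (rshift n i))) p = 0.
  apply: derive_is; apply: is_derive_affine => h.
  by rewrite dz scaler0 addr0 /grad_Dquot !partE scaler0 mulr0 !add0r.
have Dt : 'D_(delta_mx 0 (rshift (n + m) 0))
    (fun q => w (tpart q) * grad_Dquot q 0 (rshift (n + m) 0)) p =
    w (tpart p) * (k%:R / 2 * Dquot p).
  apply: derive_is; apply: is_derive_line.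
  rewrite (_ : (fun h => _) =
      (w \o (fun h => h + tpart p)) * cst (- Dnum (vpart p))); last first.
    apply/funext => h; rewrite dt -tpart_coord /grad_Dquot !partE.
    by rewrite scaler0 add0r mulr1.
  have Hw : is_derive (0 + tpart p) 1 w (- (k%:R / 2 * (tpart p)^-1 * w (tpart p))).
    rewrite add0r; exact: is_derive_rsqrtX.
  have Hs : is_derive (0 : R) 1 (fun h : R => h + tpart p) 1.
    by apply: is_derive_eq; rewrite addr0.
  have Hc : is_derive (0 : R) 1 (cst (- Dnum (vpart p))) 0 by exact: is_derive_cst.
  have Hws := @is_derive1_comp _ w (fun h => h + tpart p) 0 _ _ Hw Hs.
  apply: is_derive_eq (is_deriveM Hws Hc) _.
  by rewrite /GRing.scale /= /Dquot; ring.
under eq_bigr do rewrite Dv.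
rewrite Dt -big_distrr /= laplacian_Dnum big1 => [|i _]; last exact: Dz.
have w0 : w (tpart p) != 0.
  by rewrite expf_neq0 // invr_eq0 gt_eqF // sqrtr_gt0.
rewrite addr0 -mulrDr mulKf // /k (natrD _ (n + 2 * m)) (natrD _ n) natrM; congr (_ + _).
by field.
Qed.

End Dfun.

(** * Isoparametricity and the focal variety *)

Lemma C2_on_quadratic {R : realType} (D : set R) (a b : R) :
  C2_on D (fun x => a * x + b * x ^+ 2).
Proof.
set g := fun x => _.
have d1 (x : R) : is_derive x 1 g (a + 2 * b * x).
  rewrite /g; apply: is_derive_eq; rewrite /GRing.scale /=; ring.
have g1 : derive1 g = fun x => a + 2 * b * x.
  by apply/funext => x; rewrite derive1E; apply: derive_is.
have d2 (x : R) : is_derive x 1 (derive1 g) (2 * b).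
  rewrite g1; apply: is_derive_eq; rewrite /GRing.scale /=; ring.
have g2 : derive1 (derive1 g) = cst (2 * b).
  by apply/funext => x; rewrite derive1E; apply: derive_is.
exists setT, g; split => //; first exact: openT.
by move=> x _; split => //; rewrite g2; exact: cst_continuous.
Qed.

Section Quot.
Context {R : realType} {n m : nat} (J : clifford_module R n m).
Local Notation N := (n + m + 1)%N.
Local Notation S := (@half_space R n m).
Local Notation G := (dr_metric J).
Variables (Vb v : 'rV[R]_n) (c : R).
Local Notation num := (Dnum J Vb v c).
Local Notation D := (Dquot J Vb v c).

Lemma isoparametric_Dquot : isoparametric G S D.
Proof.
split; first exact/laurent_t_smooth/laurent_t_Dquot.
exists (fun x => 2 * (m%:R + 1) * dot v v + (n%:R / 2 + m%:R + 1) * x).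
exists (fun x => 4 * dot v v * x + 1 * x ^+ 2).
split; last 1 first.
- by move=> p p0; rewrite laplacian_Dquot // norm_grad_Dquot // mul1r.
- apply: continuous_subspaceT => x.
  by apply: cvgD; [exact: cvg_cst | apply: cvgM; [exact: cvg_cst | exact: cvg_id]].
- exact: C2_on_quadratic.
Qed.

(** On the vertical line through a point with positive numerator, the function
    is unbounded near [t = 0]. *)
Lemma no_max_Dquot V : 0 < num V -> ~ has_max_on S D.
Proof.
move=> V0 [p [p0 pmax]].
have q0 : 0 <= D p by rewrite mulr_ge0 ?Dnum_ge0 // invr_ge0 ltW.
have d0 : 0 < D p + 1 by rewrite ltr_wpDl.
pose t := num V / (D p + 1).
have t0 : 0 < t by rewrite divr_gt0.
have := pmax (pack V 0 t); rewrite /S /= !packE => /(_ t0).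
rewrite /(Dquot _ _ _ _ (pack _ _ _)) !packE /t invf_div divfK ?gt_eqF //.
by rewrite leNgt ltrDl ltr01.
Qed.

Lemma Dquot_ge0 p : S p -> 0 <= D p.
Proof. by move=> p0; rewrite mulr_ge0 ?Dnum_ge0 // invr_ge0 ltW. Qed.

Lemma Dquot_eq0 p : S p ->
  D p = 0 <-> bracket J (vpart p - Vb) v = 0 /\ dot (vpart p - Vb) v = c.
Proof.
move=> p0; rewrite -Dnum_eq0 /Dquot; split => [/eqP|->]; last by rewrite mulr0.
by rewrite mulf_eq0 invr_eq0 gt_eqF //= => /eqP.
Qed.

(** [|grad D|^2 = 4 |v|^2 D + D^2] is a sum of nonnegative terms that vanishes
    exactly where [D] does. *)
Lemma critical_Dquot p : S p ->
  grad G D p = 0 <-> D p = 0.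
Proof.
move=> p0; have E := norm_grad_Dquot J Vb v c p p0.
have q0 := Dquot_ge0 p p0.
split=> [g0|q00]; last first.
  by apply: (inner_eq0 J p) => //; rewrite E q00 mulr0 expr0n addr0.
move: E; rewrite g0 /inner mul0mx mul0mx mxE => /esym/eqP.
have a0 : 0 <= 4 * dot v v * D p.
  by apply: mulr_ge0 => //; apply: mulr_ge0 => //; exact: dot_ge0.
rewrite paddr_eq0 ?sqr_ge0 // => /andP[_].
by rewrite sqrf_eq0 => /eqP.
Qed.

Lemma focal_Dquot A : focal_variety G S D A <->
  A = level_set S D 0 /\ level_set S D 0 !=set0.
Proof.
split=> [[d [AE [p [Ap gp]]]]|[AE [p pA]]].
  move: Ap; rewrite AE => -[Sp pd].
  have p0 : D p = 0 by apply/critical_Dquot.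
  by rewrite -pd p0; split => //; exists p.
exists 0; split => //; exists p; rewrite AE; split => //.
by apply/critical_Dquot; case: pA.
Qed.

Lemma min_Dquot : level_set S D 0 !=set0 -> is_min_on S D 0.
Proof. by move=> [p [Sp p0]]; split; [exists p | exact: Dquot_ge0]. Qed.

End Quot.

Section Focal.
Context {R : realType} {n m : nat} (J : clifford_module R n m).
Local Notation N := (n + m + 1)%N.
Local Notation S := (@half_space R n m).
Variables (Vb v : 'rV[R]_n) (tb s : R).

Lemma DstarE : Dstar J Vb tb v s = Dquot J Vb v (2 * s * Num.sqrt tb).
Proof. by apply/funext => x; rewrite /Dstar sqr_enorm. Qed.

Lemma FstarE : Fstar J Vb tb v s = level_set S (Dquot J Vb v (2 * s * Num.sqrt tb)) 0.
Proof.
apply/seteqP; split=> x /=.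
  by move=> [x0 h1 h2]; split => //; apply/Dquot_eq0.
by move=> [x0 /(Dquot_eq0 _ _ _ _ _ x0) []].
Qed.

Lemma Fstar_affine : v <> 0 ->
  Fstar J Vb tb v s = S `&`
    [set pack (Vb + (2 * s * Num.sqrt tb / enorm v ^+ 2) *: v) 0 0 + x
    | x in focal_direction J v].
Proof.
move=> /eqP v0; have vv : dot v v != 0 by rewrite dot_eq0.
rewrite sqr_enorm; set l := _ / _.
have E (x : 'rV[R]_N) : vpart (x - pack (Vb + l *: v) 0 0) = vpart x - Vb - l *: v.
  by rewrite packN partE packE opprD addrA.
have lE : l * dot v v = 2 * s * Num.sqrt tb by rewrite /l divfK.
apply/seteqP; split=> x.
  move=> [x0 h1 h2]; split => //; exists (x - pack (Vb + l *: v) 0 0); last first.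
    by rewrite addrC subrK.
  split; rewrite E.
    by rewrite bracketDr bracketNr bracketZr bracketxx bracketC h1 scaler0 !oppr0 addr0.
  by rewrite dotDl dotNl dotZl h2 lE subrr.
move=> [x0 [y [h1 h2] yx]].
have yE : vpart y = vpart x - Vb - l *: v by rewrite -E -yx addrAC subrr add0r.
have xE : vpart x - Vb = vpart y + l *: v by rewrite yE subrK.
split => //; rewrite xE.
  by rewrite bracketDl bracketZl bracketxx bracketC h1 scaler0 oppr0 addr0.
by rewrite dotDl dotZl h2 add0r.
Qed.

Lemma Fstar_nonempty : v <> 0 -> Fstar J Vb tb v s !=set0.
Proof.
move=> v0; rewrite Fstar_affine //.
exists (pack (Vb + (2 * s * Num.sqrt tb / enorm v ^+ 2) *: v) 0 1); split.
  by rewrite /half_space /= packE ltr01.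
exists (pack 0 0 1); last by rewrite packD !addr0 add0r.
by split; rewrite packE ?bracket0r ?dot0l.
Qed.

(** [<[v, u], Z> = <J_Z v, u>]: the bracket with [v] is adjoint to
    [Z |-> J Z v]. *)
Lemma focal_directionE : focal_direction J v =
  orthocomp [set (pack (J Z v + a *: v) 0 0 : 'rV[R]_N)
            | Z in [set: 'rV[R]_m] & a in [set: R]].
Proof.
apply/seteqP; split=> x /=.
  move=> [h1 h2] _ [Z _ [a _ <-]].
  rewrite dot_parts !packE dot0r mulr0 !addr0 dotDr dotZr h2 mulr0 addr0.
  by rewrite dotC -bracketP h1 dot0l.
move=> h; split.
  apply/rowP => i; rewrite mxE [RHS]mxE.
  have := h (pack (J (delta_mx 0 i) v) 0 0); rewrite dot_parts !packE.
  rewrite dot0r mulr0 !addr0 dotC; apply.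
  by exists (delta_mx 0 i) => //; exists 0 => //; rewrite scale0r addr0.
have := h (pack v 0 0); rewrite dot_parts !packE dot0r mulr0 !addr0; apply.
by exists 0 => //; exists 1 => //; rewrite cliff0l add0r scale1r.
Qed.

End Focal.

(** * Minimality of the focal variety *)

Lemma gram_unit {R : realType} {k l : nat} (Q : 'M[R]_(k, l)) :
  row_free Q -> Q *m Q^T \in unitmx.
Proof.
move=> Qf; rewrite -row_free_unit; apply: inj_row_free => x x0.
have : dot (x *m Q) (x *m Q) == 0.
  by rewrite dot_mulmxT trmx_mul mulmxA -(mulmxA x) x0 mul0mx mxE.
by rewrite dot_eq0 => /eqP xQ0; apply: (row_free_inj Qf); rewrite mul0mx.
Qed.

(** [Q^T (Q Q^T)^-1 Q] is the orthogonal projection onto the row space of [Q],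
    so it fixes the rows of [E]; by cyclicity of the trace, the left-hand side
    is the trace of [(E H)^T]. *)
Lemma gram_trace0 {R : realType} {k l d : nat} (Q : 'M[R]_(k, l))
    (E : 'M[R]_(d, l)) (H : 'M[R]_(l, d)) :
  row_free Q -> (E <= Q)%MS -> E *m H = 0 ->
  \tr (invmx (Q *m Q^T) *m ((Q *m E^T) *m (Q *m H)^T)) = 0.
Proof.
move=> Qf /submxP[C EC] EH; set g := Q *m Q^T.
have gu : g \in unitmx by exact: gram_unit.
have gT : g^T = g by rewrite trmx_mul trmxK.
have proj : Q^T *m invmx g *m Q *m E^T = E^T.
  apply: trmx_inj; rewrite !trmx_mul !trmxK trmx_inv gT EC !mulmxA.
  by rewrite -(mulmxA C Q) mulmxK.
rewrite mulmxA mxtrace_mulC trmx_mul -!mulmxA (mulmxA Q^T) (mulmxA _ Q) proj.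
by rewrite -trmx_mul EH linear0 mxtrace0.
Qed.

Section FocalBasis.
Context {R : realType} {n m : nat} (J : clifford_module R n m).
Local Notation N := (n + m + 1)%N.

(** The linear map [x |-> ([v, x_v], <x_v, v>)], whose kernel is
    [focal_direction J v], is onto: composed with its adjoint it is [|v|^2]
    times the identity. So the kernel has dimension [n + m + 1 - (m + 1) = n]. *)
Lemma focal_basis (v : 'rV[R]_n) : v <> 0 -> exists P : 'M[R]_(n, N),
  row_free P /\ forall x, focal_direction J v x <-> (x <= P)%MS.
Proof.
move=> /eqP v0; have vv : dot v v != 0 by rewrite dot_eq0.
pose f (x : 'rV[R]_N) : 'rV[R]_(m + 1) :=
  row_mx (bracket J v (vpart x)) (dot (vpart x) v)%:M.
pose f' (y : 'rV[R]_(m + 1)) : 'rV[R]_N :=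
  pack (J (lsubmx y) v + (rsubmx y) 0 0 *: v) 0 0.
have lf : linear f.
  move=> a x y; rewrite /f !partE bracketDr bracketZr dotDl dotZl.
  by rewrite scale_row_mx add_row_mx scale_scalar_mx raddfD.
have lf' : linear f'.
  move=> a x y; rewrite /f' packZ packD mulr0 !scaler0 !addr0 !linearP /=.
  rewrite cliffDl cliffZl !mxE; congr (pack _ _ _).
  by rewrite scalerDl scalerDr scalerA addrACA.
have ff' y : f (f' y) = dot v v *: y.
  rewrite /f /f' packE bracketDr bracketZr bracketxx scaler0 addr0.
  rewrite -[y in RHS]hsubmxK scale_row_mx; congr (row_mx _ _).
    apply: dot_ext => Z; rewrite bracketP dotZl.
    by rewrite dot_cliff2 (dotC Z) mulrC.
  rewrite dotDl cliff_perp add0r dotZl mulrC -scale_scalar_mx; congr (_ *: _).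
  by rewrite -mx11_scalar.
pose F : 'M[R]_(N, m + 1) := \matrix_(i < N) f (delta_mx 0 i).
pose F' : 'M[R]_(m + 1, N) := \matrix_(i < m + 1) f' (delta_mx 0 i).
have FE x : x *m F = f x by exact: mul_rV_rows.
have F'F : F' *m F = (dot v v)%:M.
  apply/row_matrixP => i; rewrite row_mul rowK FE ff' !rowE.
  by rewrite mul_mx_scalar.
have rF : \rank F = (m + 1)%N.
  apply/eqP; rewrite eqn_leq rank_leq_col /=.
  have := mxrankM_maxr F' F; rewrite F'F mxrank_unit //.
  by rewrite unitmxE det_scalar unitrX // unitfE.
have rK : \rank (kermx F) = n by rewrite mxrank_ker rF -addnA addnK.
exists (castmx (rK, erefl N) (row_base (kermx F))); split.
  by rewrite row_free_castmx row_base_free.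
move=> x; rewrite eqmx_cast eq_row_base.
split=> [[h1 h2]|/sub_kermxP].
  by apply/sub_kermxP; rewrite FE /f h1 h2 raddf0 row_mx0.
rewrite FE /f -row_mx0 => /eq_row_mx [h1 /matrixP/(_ 0 0)]; rewrite /focal_direction /= h1.
by rewrite !mxE mulr1n.
Qed.

Lemma affine_subspace_rows {d : nat} (a : 'rV[R]_N) (P : 'M[R]_(d, N))
    (K : set 'rV[R]_N) :
  row_free P -> (forall x, K x <-> (x <= P)%MS) ->
  affine_subspace d [set a + x | x in K].
Proof.
move=> Pf KE; pose h : 'Hom('rV[R]_d, 'rV[R]_N) := linfun (mulmxr P).
have kerh : (fullv :&: lker h)%VS = 0%VS.
  apply/eqP; rewrite -subv0; apply/subvP => y.
  rewrite memv_cap memv_ker lfunE /= memv0 => /andP[_ /eqP yP].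
  by apply/eqP/(row_free_inj Pf); rewrite mul0mx.
exists a, (limg h); split.
  by rewrite (limg_dim_eq kerh) dimvf /dim /= mul1n.
congr image; apply/seteqP; split=> x /=.
  move/KE => /submxP[y ->]; apply/memv_imgP; exists y; first exact: memvf.
  by rewrite lfunE.
by move=> /memv_imgP[y _ ->]; rewrite lfunE /=; apply/KE; exact: submxMl.
Qed.

End FocalBasis.

Section Minimal.
Context {R : realType} {n m : nat} (J : clifford_module R n m).
Local Notation N := (n + m + 1)%N.
Local Notation S := (@half_space R n m).
Local Notation G := (dr_metric J).
Implicit Types p X Y Z : 'rV[R]_N.

(** Central component of [X] in the left trivialization at [p], up to the
    factor [1 / t]. *)
Definition hat p X : 'rV[R]_m := zpart X - 2^-1 *: bracket J (vpart p) (vpart X).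

Lemma innerE_hat p X Y : S p -> inner G p X Y =
  (tpart p)^-1 * dot (vpart X) (vpart Y) +
  (tpart p)^-1 * (tpart p)^-1 * (dot (hat p X) (hat p Y) + tpart X * tpart Y).
Proof. by move=> p0; rewrite innerE // dot_trivialize // -exprVn expr2. Qed.

Lemma hat_line p X Y h :
  hat (h *: X + p) Y = hat p Y - h *: (2^-1 *: bracket J (vpart X) (vpart Y)).
Proof.
rewrite /hat !partE bracketDl bracketZl.
move: (bracket _ _ _) (bracket _ _ _) => b1 b2.
by apply/rowP => i; rewrite !mxE; ring.
Qed.

Lemma is_derive_inner p X Y Z : S p ->
  is_derive p X (fun q => inner G q Y Z)
    (- tpart X * (tpart p)^-1 ^+ 2 * dot (vpart Y) (vpart Z)
     - 2 * tpart X * (tpart p)^-1 ^+ 3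
       * (dot (hat p Y) (hat p Z) + tpart Y * tpart Z)
     - 2^-1 * (tpart p)^-1 ^+ 2
       * (dot (bracket J (vpart X) (vpart Y)) (hat p Z)
          + dot (hat p Y) (bracket J (vpart X) (vpart Z)))).
Proof.
move=> p0.
pose t' (q : 'rV[R]_N) := (tpart q)^-1.
pose f q := dot (hat q Y) (hat q Z) + tpart Y * tpart Z.
apply: (@near_eq_is_derive _ _ _ (t' * cst (dot (vpart Y) (vpart Z)) + t' * t' * f)).
  have : nbhs p S by apply: open_nbhs_nbhs; split; [exact: open_half_space | ].
  by apply: filterS => q q0; rewrite innerE_hat.
have dt := is_derive_tpartV p X p0.
have df : is_derive p X f (- (2^-1 * (dot (bracket J (vpart X) (vpart Y)) (hat p Z)
          + dot (hat p Y) (bracket J (vpart X) (vpart Z))))).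
  apply: (@is_derive_quadratic _ _ _ _ _ _ (4^-1 *
    dot (bracket J (vpart X) (vpart Y)) (bracket J (vpart X) (vpart Z)))) => h.
  by rewrite /f !hat_line !dotE; field.
have dc : is_derive p X (cst (dot (vpart Y) (vpart Z))) 0 by exact: is_derive_cst.
apply: is_derive_eq (is_deriveD (is_deriveM dt dc) (is_deriveM (is_deriveM dt dt) df)) _.
by rewrite /GRing.scale /= /f /t' !fctE; ring.
Qed.

(** The form only pairs the central component of one argument with the
    [v]-component of the other: this is what makes the trace vanish. *)
Lemma koszul_normal p X Y xi : S p ->
  hat p xi = 0 -> tpart xi = 0 ->
  dot (vpart X) (vpart xi) = 0 -> dot (vpart Y) (vpart xi) = 0 ->
  koszul G p X Y xi = - 2^-1 * (tpart p)^-1 ^+ 2 *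
    (dot (hat p Y) (bracket J (vpart X) (vpart xi))
     + dot (hat p X) (bracket J (vpart Y) (vpart xi))).
Proof.
move=> p0 h0 t0 X0 Y0; rewrite /koszul.
rewrite !(derive_is _ _ _ _ (is_derive_inner _ _ _ _ p0)).
rewrite h0 t0 X0 Y0 !dot0r (bracketC _ (vpart xi) (vpart X)).
rewrite (bracketC _ (vpart xi) (vpart Y)) dotNl dotNr.
rewrite (dotC (bracket J (vpart X) (vpart xi))).
by field; rewrite gt_eqF.
Qed.

(** The affine chart [y |-> a + y P] has vanishing second derivatives, so the
    second form is the Koszul term alone. A normal vector [xi] is orthogonal to
    all [(0, Z, t)], which forces its central and vertical components to
    vanish, as [koszul_normal] requires. *)
Lemma minimal_affine (a : 'rV[R]_N) (P : 'M[R]_(n, N)) (F K : set 'rV[R]_N) :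
  row_free P -> (forall x, K x <-> (x <= P)%MS) ->
  (forall (w : 'rV[R]_m) t, K (pack 0 w t)) ->
  F = S `&` [set a + x | x in K] ->
  @minimal_submanifold R n _ G S F.
Proof.
move=> Pf KE Kzt ->; split=> [x []//|p [p0 _]].
pose phi (y : 'rV[R]_n) := a + y *m P.
have aff_cont k l (b : 'rV[R]_l) (Q : 'M[R]_(k, l)) :
    continuous (fun x : 'rV[R]_k => b + x *m Q).
  by move=> x; apply: differentiable_continuous; apply: (affine_smooth b Q setT openT [::]).
have oO : open (phi @^-1` S).
  by apply: open_comp; [move=> x _; exact: aff_cont | exact: open_half_space].
have Dphi y w : 'D_w phi y = w *m P.
  apply: derive_is; apply: is_derive_affine => h.
  by rewrite /phi mulmxDl -scalemxAl addrCA addrC.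
have jacE y : jac phi y = P.
  by apply/row_matrixP => i; rewrite rowK Dphi rowE.
exists (phi @^-1` S), setT, phi, (fun x => - a *m pinvmx P + x *m pinvmx P).
split.
- by split => //; exact: affine_smooth.
- by split => //; exact: openT.
- rewrite setIT; apply/seteqP; split=> [_ [y y0 <-]|x [x0 [z /KE /submxP[y ->] xE]]].
    split => //; exists (y *m P) => //; apply/KE; exact: submxMl.
  by exists y => //; rewrite /= /phi xE.
- split; first by apply: continuous_subspaceT; exact: aff_cont.
  by move=> y _; rewrite /phi -mulmxDl addKr mulmxKp.
move=> y y0; rewrite jacE; split => // xi xi0.
(* An opaque name for the base point, so that its coordinates are not
   decomposed along [a + y P]. *)
have [q qE] : {q | phi y = q} by exists (phi y).
rewrite qE in xi0; have q0 : S q by rewrite -qE.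
pose Q := P *m triv_mx J q.
have Qf : row_free Q by rewrite /row_free mxrankMfree // row_free_unit triv_mx_unit.
have ffE : first_form G phi y = Q *m Q^T.
  by rewrite /first_form jacE qE dr_metricE // trmx_mul !mulmxA.
have nK X : K X -> inner G q X xi = 0.
  move/KE => /submxP[c ->]; rewrite /inner -mulmxA -mulmxA.
  suff -> : P *m (G q *m xi^T) = 0 by rewrite mulmx0 mxE.
  apply/row_matrixP => i; rewrite row_mul row0 mulmxA.
  by apply/rowP => j; rewrite !ord1 [RHS]mxE; exact: xi0.
have tq0 : ((tpart q)^-1 == 0) = false by rewrite invr_eq0 gt_eqF.
have hatP (w : 'rV[R]_m) t : hat q (pack 0 w t) = w.
  by rewrite /hat !packE bracket0r scaler0 subr0.
have tau0 : tpart xi = 0.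
  have := nK _ (Kzt 0 1); rewrite innerE_hat // hatP !packE.
  rewrite !dot0l mulr0 !add0r mul1r => /eqP.
  by rewrite !mulf_eq0 !tq0 /= => /eqP.
have hat0 : hat q xi = 0.
  have := nK _ (Kzt (hat q xi) 0); rewrite innerE_hat // hatP !packE.
  rewrite !dot0l mulr0 !add0r mul0r addr0 => /eqP.
  by rewrite !mulf_eq0 !tq0 /= dot_eq0 => /eqP.
have u0 X : K X -> dot (vpart X) (vpart xi) = 0.
  move/nK; rewrite innerE_hat // hat0 dot0r tau0 mulr0 addr0 mulr0 addr0 => /eqP.
  by rewrite mulf_eq0 tq0 /= => /eqP.
have Krow i : K (row i P) by apply/KE; exact: row_sub.
(* The trace of the form is computed by [gram_trace0], with the rows of [E] the
   basis of [z], which the trivialized tangent space contains, and [H] the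
   matrix of [x |-> [x_v, xi_v]]. *)
pose f (x : 'rV[R]_N) : 'rV[R]_m := bracket J (vpart x) (vpart xi).
have lf : linear f by move=> b X Y; rewrite /f !partE bracketDl bracketZl.
pose g (x : 'rV[R]_m) : 'rV[R]_N := pack 0 x 0.
have lg : linear g by move=> b X Y; rewrite /g packZ packD !scaler0 !mulr0 !addr0.
pose H : 'M[R]_(N, m) := \matrix_(i < N) f (delta_mx 0 i).
pose E : 'M[R]_(m, N) := \matrix_(i < m) g (delta_mx 0 i).
have EE x : x *m E = g x by exact: mul_rV_rows.
have HE x : x *m H = f x by exact: mul_rV_rows.
have EH : E *m H = 0.
  by apply/row_matrixP => i; rewrite row_mul rowK HE /f packE bracket0l row0.
have EQ : (E <= Q)%MS.
  have -> : E = (tpart q *: E) *m triv_mx J q.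
    apply/row_matrixP => i; rewrite row_mul !rowE -scalemxAr EE.
    rewrite mul_triv_mx /trivialize /g !partE !scaler0 mulr0 bracket0r scaler0.
    by rewrite mulr0 subr0 scalerA mulVf ?scale1r ?gt_eqF.
  apply: submxMr; apply/row_subP => i; rewrite rowE -scalemxAr EE.
  by apply/KE; rewrite /g packZ scaler0 mulr0; exact: Kzt.
pose M := (Q *m E^T) *m (Q *m H)^T.
pose r := Num.sqrt (tpart q).
have r0 : r != 0 by rewrite gt_eqF // sqrtr_gt0.
have ME i j : M i j = (tpart q)^-1 * r^-1 *
    dot (hat q (row i P)) (bracket J (vpart (row j P)) (vpart xi)).
  have -> : M i j = dot (row i (Q *m E^T)) (row j (Q *m H)).
    by rewrite mxE; apply: eq_bigr => l _; rewrite !mxE.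
  rewrite !row_mul !mul_triv_mx HE dot_tr trmxK EE dot_parts /g /f /trivialize.
  by rewrite !packE !dot0r mulr0 addr0 add0r bracketZl dotZl dotZr mulrA.
have SE i j : second_form G phi y xi i j =
    - (2^-1 * (tpart q)^-1 * r) * (M j i + M i j).
  rewrite /second_form jacE qE (funext (Dphi^~ (delta_mx 0 j))).
  rewrite derive_cst /inner !mul0mx mxE add0r.
  rewrite koszul_normal // ?u0 // !ME.
  by field; rewrite r0 gt_eqF.
have -> : \sum_(i < n) \sum_(j < n)
    invmx (first_form G phi y) i j * second_form G phi y xi i j =
  - (2^-1 * (tpart q)^-1 * r) *
    (\tr (invmx (Q *m Q^T) *m M) + \tr (invmx (Q *m Q^T) *m M^T)).
  rewrite ffE -mxtraceD -mulmxDr big_distrr; apply: eq_bigr => i _ /=.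
  rewrite mxE big_distrr; apply: eq_bigr => j _ /=.
  by rewrite SE [(M + M^T) j i]mxE [M^T j i]mxE mulrCA.
rewrite gram_trace0 // add0r -mxtrace_tr trmx_mul trmxK trmx_inv trmx_mul trmxK.
by rewrite mxtrace_mulC gram_trace0 // mulr0.
Qed.

End Minimal.

(** * The prolonged geodesic as a conic *)

Section HPoint.
Context {R : realType}.

Lemma hpointZ k (c : R) (y : 'rV[R]_k) : c != 0 -> hpoint (c *: y) = hpoint y.
Proof.
move=> c0; rewrite /hpoint !dotE [(c *: y)^T]linearZ /= -scalemxAl -scalemxAr !scalerA.
have [->|d0] := eqVneq (dot y y) 0; first by rewrite !mulr0 invr0 !mul0r.
by congr (_ *: _); field; rewrite c0 d0.
Qed.

Lemma hpointE k (y : 'rV[R]_k) i j : hpoint y i j = (dot y y)^-1 * (y 0 i * y 0 j).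
Proof. by rewrite /hpoint !mxE big_ord1 !mxE. Qed.

(** The trace of the rank one matrix [(y M)^T (y M)] is [|y M|^2], which is the
    normalization of [hpoint (y *m M)]. *)
Lemma proj_action_hpoint k (M : 'M[R]_k) (y : 'rV[R]_k) : y != 0 ->
  proj_action M (hpoint y) = hpoint (y *m M).
Proof.
move=> y0; have d0 : dot y y != 0 by rewrite dot_eq0.
rewrite /proj_action /hpoint -scalemxAr -scalemxAl.
have -> : M^T *m (y^T *m y) *m M = (y *m M)^T *m (y *m M).
  by rewrite trmx_mul !mulmxA.
rewrite mxtraceZ mxtrace_mulC trace_mx11 -dot_mulmxT scalerA; congr (_ *: _).
by rewrite invfM invrK mulrAC mulfV ?mul1r.
Qed.

Lemma continuous_rsum k (f : 'I_k -> R -> R) (x : R) :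
  (forall i, {for x, continuous (f i)}) ->
  {for x, continuous (fun y => \sum_i f i y)}.
Proof.
move=> cf; rewrite (_ : (fun _ => _) = \sum_i f i); last first.
  by apply/funext => y; rewrite fct_sumE.
elim/big_ind: _ => [|g h cg ch|i _]; last exact: cf.
  exact: cst_continuous.
exact: continuousD.
Qed.

Lemma continuous_hpoint_entry k (H : R -> 'rV[R]_k) (x : R) i j : H x != 0 ->
  (forall l, continuous (fun y => H y 0 l)) ->
  {for x, continuous (fun y => hpoint (H y) i j)}.
Proof.
move=> Hx cH; rewrite (_ : (fun y => _) = fun y =>
  (dot (H y) (H y))^-1 * (H y 0 i * H y 0 j)); last first.
  by apply/funext => y; exact: hpointE.
apply: continuousM; last by apply: continuousM; exact: cH.
apply: continuousV; first by rewrite dot_eq0.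
by apply: continuous_rsum => l; apply: continuousM; exact: cH.
Qed.

Lemma continuous_eq_at (f g : R -> R) (x : R) :
  {for x, continuous f} -> {for x, continuous g} ->
  (forall y, y != x -> f y = g y) -> f x = g x.
Proof.
move=> cf cg fg.
have cf' : f y @[y --> x^'] --> f x by apply: cvg_within_filter; exact: cf.
have cg' : g y @[y --> x^'] --> g x by apply: cvg_within_filter; exact: cg.
apply: (@cvg_unique _ _ (g y @[y --> x^']) _ _ _ _ cg') => //.
apply: cvg_trans cf'; apply: near_eq_cvg; near=> y.
by apply: fg; near: y; exact: nbhs_dnbhs_neq.
Unshelve. all: by end_near. Qed.

(** The chart of the projective line at its point at infinity. *)
Definition opc_inv (q : R) : one_point_compactification R :=
  if q == 0 then None else Some q^-1.

Lemma continuous_opc_inv0 : {for 0, continuous opc_inv}.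
Proof.
move=> A; rewrite {1}/opc_inv eqxx => -[U [cU _] UA].
have [M [Mr MU]] := compact_bounded cU.
have M1 : 0 < `|M| + 1 by rewrite ltr_wpDl.
have MU1 : forall y, U y -> `|y| <= `|M| + 1.
  by apply: MU; rewrite ltr_pwDr // real_ler_norm.
suff : \forall q \near (0 : R), A (opc_inv q) by [].
near=> q; apply: UA; rewrite /opc_inv.
have [_|q0] := eqVneq q 0; first by right.
left; exists q^-1 => // /MU1; apply/negP; rewrite -ltNge normfV.
rewrite -[ltLHS]invrK ltf_pV2 ?posrE ?invr_gt0 ?normr_gt0 //.
Unshelve. all: by end_near. Qed.

(** [H] is the curve in homogeneous coordinates [(p, q)] on the projective line.
    The point [x0] is a possible pole of the affine formula: there, and at
    infinity, the value of [gam] is the limit along the nearby parameters, where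
    it is known. *)
Lemma prolongation_range k (gam : one_point_compactification R -> 'M[R]_k)
    (H : R -> R -> 'rV[R]_k) (d : nat) (x0 : R) :
  continuous gam ->
  (forall c p q, H (c * p) (c * q) = c ^+ d *: H p q) ->
  (forall p q, (p != 0) || (q != 0) -> H p q != 0) ->
  (forall l, continuous (fun p => H p 1 0 l)) ->
  (forall l, continuous (fun q => H 1 q 0 l)) ->
  (forall x, x != x0 -> gam (Some x) = hpoint (H x 1)) ->
  range gam = [set hpoint (H pq.1 pq.2) | pq in [set pq | (pq.1 != 0) || (pq.2 != 0)]].
Proof.
move=> cgam Hh Hn cH1 cH2 gamE.
have gamS x : gam (Some x) = hpoint (H x 1).
  have [->|] := eqVneq x x0; last exact: gamE.
  apply/matrixP => i j.
  apply: (continuous_eq_at (fun y => gam (Some y) i j)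
                           (fun y => hpoint (H y 1) i j)).
  - apply: (@continuous_comp _ _ _ (gam \o Some) (fun M : 'M[R]_k => M i j)).
      apply: continuous_comp; last exact: cgam.
      exact: one_point_compactification_some_continuous.
    exact: coord_continuous.
  - by apply: continuous_hpoint_entry => //; apply: Hn; rewrite oner_eq0 orbT.
  - by move=> y yx; rewrite gamE.
have gamN : gam None = hpoint (H 1 0).
  apply/matrixP => i j.
  have -> : None = opc_inv 0 by rewrite /opc_inv eqxx.
  apply: (continuous_eq_at (fun y => gam (opc_inv y) i j)
                           (fun y => hpoint (H 1 y) i j)).
  - apply: (@continuous_comp _ _ _ (gam \o opc_inv) (fun M : 'M[R]_k => M i j)).
      apply: continuous_comp; last exact: cgam.
      exact: continuous_opc_inv0.
    exact: coord_continuous.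
  - by apply: continuous_hpoint_entry => //; apply: Hn; rewrite oner_eq0.
  - move=> y y0; rewrite /opc_inv (negbTE y0) gamS.
    have -> : H y^-1 1 = y^-1 ^+ d *: H 1 y by rewrite -Hh mulr1 mulVf.
    by rewrite hpointZ // expf_neq0 // invr_eq0.
apply/seteqP; split=> [_ [[x|] _ <-]|_ [[p q] /= pq0 <-]].
- by exists (x, 1) => //=; rewrite oner_eq0 orbT.
- by exists (1, 0) => //=; rewrite oner_eq0.
- have [q0|q0] := eqVneq q 0.
    exists None => //; rewrite gamN.
    have p0 : p != 0 by move: pq0; rewrite q0 eqxx orbF.
    have -> : H p q = p ^+ d *: H 1 0 by rewrite -Hh mulr1 mulr0 q0.
    by rewrite hpointZ // expf_neq0.
  exists (Some (p / q)) => //; rewrite gamS.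
  have -> : H p q = q ^+ d *: H (p / q) 1.
    by rewrite -Hh mulr1 mulrCA mulfV ?mulr1.
  by rewrite hpointZ // expf_neq0.
Qed.

End HPoint.

Section Conics.
Context {R : realType} {N : nat}.
Implicit Types x y a u w : 'rV[R]_N.

Definition homog x (c : R) : 'rV[R]_(N + 1) := row_mx x c%:M.

Lemma homogZ b x c : b *: homog x c = homog (b *: x) (b * c).
Proof. by rewrite /homog scale_row_mx scale_scalar_mx. Qed.

Lemma homogD x y c d : homog x c + homog y d = homog (x + y) (c + d).
Proof. by rewrite /homog add_row_mx raddfD. Qed.

Lemma homog_eq0 x c : (homog x c == 0) = (x == 0) && (c == 0).
Proof.
apply/eqP/andP=> [|[/eqP -> /eqP ->]]; last by rewrite /homog raddf0 row_mx0.
rewrite /homog -row_mx0 => /eq_row_mx [-> /matrixP/(_ 0 0)].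
by rewrite !mxE mulr1n => ->.
Qed.

Lemma homog_l x c i : homog x c 0 (lshift 1 i) = x 0 i.
Proof. by rewrite /homog row_mxEl. Qed.

Lemma homog_r x c : homog x c 0 (rshift N 0) = c.
Proof. by rewrite /homog row_mxEr mxE mulr1n. Qed.

Lemma affine_pointE x c : c != 0 -> hpoint (homog x c) = affine_point (c^-1 *: x).
Proof.
move=> c0; rewrite /affine_point -/(homog _ _) -[in RHS](hpointZ _ c) //.
by rewrite homogZ scalerA mulfV // scale1r mulr1.
Qed.

Lemma infinity_pointE x c : c != 0 -> hpoint (homog (c *: x) 0) = infinity_point x.
Proof.
move=> c0; rewrite /infinity_point -[in RHS](hpointZ _ c) // scale_row_mx scaler0.
by rewrite /homog raddf0.
Qed.

Lemma affine_point_inj : injective (@affine_point R N).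
Proof.
move=> x y /matrixP xy.
have pos z : dot (homog z 1) (homog z 1) != 0.
  by rewrite dot_eq0 homog_eq0 oner_eq0 andbF.
have := xy (rshift N 0) (rshift N 0); rewrite !hpointE -!/(homog _ _) !homog_r.
rewrite !mulr1 => /(congr1 GRing.inv); rewrite !invrK => dE.
apply/rowP => i; have := xy (lshift 1 i) (rshift N 0).
rewrite !hpointE -!/(homog _ _) !homog_r !homog_l !mulr1 dE.
by apply: mulfI; rewrite invr_eq0.
Qed.

Lemma affine_neq_infinity x u : affine_point x <> infinity_point u.
Proof.
move=> /matrixP/(_ (rshift N 0) (rshift N 0)); rewrite !hpointE -!/(homog _ _).
have -> : row_mx u 0 = homog u 0 by rewrite /homog raddf0.
rewrite !homog_r !mulr1 !mulr0 => /eqP.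
by rewrite invr_eq0 dot_eq0 homog_eq0 oner_eq0 andbF.
Qed.

(** If the points of parameters [0], [1] and [-1] lie on a line of direction
    [u], then the two directions of the parabola are multiples of [u], which
    contradicts their orthogonality. *)
Lemma parabola_not_line (C : set 'M[R]_(N + 1)) u :
  parabola_with_infinity C -> ~ line_with_infinity u C.
Proof.
move=> [a [b [w [b0 w0 bw CE]]]] [u0 [a' CE']].
have in_line (k : R) : exists r : R, a + k *: b + k ^+ 2 *: w = a' + r *: u.
  have : C (affine_point (a + k *: b + k ^+ 2 *: w)) by rewrite CE; left; exists k.
  rewrite CE' => -[[r _ /affine_point_inj <-]|]; first by exists r.
  by move/affine_neq_infinity.
have [r0 e0] := in_line 0; have [r1 e1] := in_line 1; have [r2 e2] := in_line (-1).
have wE : w = ((r1 + r2) / 2 - r0) *: u.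
  apply/rowP => i.
  move: e0 e1 e2 => /rowP/(_ i) + /rowP/(_ i) + /rowP/(_ i).
  by rewrite !mxE => h0 h1 h2; lra.
have bE : b = ((r1 - r2) / 2) *: u.
  apply/rowP => i.
  move: e1 e2 => /rowP/(_ i) + /rowP/(_ i).
  by rewrite !mxE => h1 h2; lra.
move: (_ - r0) ((_ - _) / 2) wE bE => c1 c2 wE bE.
move: bw; rewrite bE wE !dotE => /eqP; rewrite !mulf_eq0 dot_eq0 (negbTE u0) orbF.
case/orP => /eqP h.
  by move: b0; rewrite bE h scale0r eqxx.
by move: w0; rewrite wE h scale0r eqxx.
Qed.

Lemma parabola_homog (C : set 'M[R]_(N + 1)) a u w :
  u != 0 -> w != 0 -> dot u w = 0 ->
  C = [set hpoint (homog (xy.2 ^+ 2 *: a + (xy.1 * xy.2) *: u + xy.1 ^+ 2 *: w)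
                         (xy.2 ^+ 2))
      | xy in [set xy : R * R | (xy.1 != 0) || (xy.2 != 0)]] ->
  parabola_with_infinity C.
Proof.
move=> u0 w0 uw ->; exists a, u, w; split => //.
apply/seteqP; split=> [_ [[x y] /= xy0 <-]|_ /= [[x _ <-]|->]].
- have [y0|y0] := eqVneq y 0.
    right; have x0 : x != 0 by move: xy0; rewrite y0 eqxx orbF.
    rewrite y0 mulr0 expr0n !scale0r !add0r infinity_pointE //.
    by rewrite expf_neq0.
  left; exists (x / y) => //; rewrite affine_pointE ?expf_neq0 //.
  congr affine_point; rewrite !scalerDr !scalerA.
  by congr (_ + _ *: _ + _ *: _); [rewrite mulVf ?scale1r ?expf_neq0|field..].
- exists (x, 1) => /=; first by rewrite oner_eq0 orbT.
  by rewrite expr1n mulr1 scale1r.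
- exists (1, 0) => /=; first by rewrite oner_eq0.
  by rewrite mulr0 expr0n !scale0r !add0r expr1n infinity_pointE.
Qed.

Lemma line_homog (C : set 'M[R]_(N + 1)) a u (b : R) : u != 0 -> b != 0 ->
  C = [set hpoint (homog ((xy.1 * b) *: u + xy.2 *: a) xy.2)
      | xy in [set xy : R * R | (xy.1 != 0) || (xy.2 != 0)]] ->
  line_with_infinity u C.
Proof.
move=> u0 b0 ->; split => //; exists a.
apply/seteqP; split=> [_ [[x y] /= xy0 <-]|_ /= [[x _ <-]|->]].
- have [y0|y0] := eqVneq y 0.
    right; have x0 : x != 0 by move: xy0; rewrite y0 eqxx orbF.
    by rewrite y0 scale0r addr0 infinity_pointE // mulf_neq0.
  left; exists (y^-1 * (x * b)) => //; rewrite affine_pointE //.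
  by rewrite scalerDr !scalerA mulVf // scale1r addrC.
- exists (x / b, 1) => /=; first by rewrite oner_eq0 orbT.
  by rewrite divfK // scale1r addrC.
- exists (1, 0) => /=; first by rewrite oner_eq0.
  by rewrite scale0r addr0 mul1r infinity_pointE.
Qed.

End Conics.

Lemma homog_affine_mx {R : realType} {N : nat} (f L : 'rV[R]_N -> 'rV[R]_N) x c :
  linear L -> (forall y, f y = f 0 + L y) ->
  homog x c *m affine_mx f = homog (L x + c *: f 0) c.
Proof.
move=> lL fE; rewrite /homog /affine_mx mul_row_block mulmx0 add0r mulmx1.
congr (row_mx (_ + _) _); last exact: mul_scalar_mx.
rewrite (_ : (\matrix_i _) = \matrix_(i < N) L (delta_mx 0 i)) ?mul_rV_rows //.
by apply/row_matrixP => i; rewrite !rowK fE addrAC subrr add0r.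
Qed.

Section Eta.
Context {R : realType} {n m : nat} (J : clifford_module R n m).
Local Notation N := (n + m + 1)%N.
Variables (Vb : 'rV[R]_n) (Zb : 'rV[R]_m) (tb : R).

Definition transl_lin (x : 'rV[R]_N) : 'rV[R]_N :=
  pack (Num.sqrt tb *: vpart x)
       (tb *: zpart x + (2^-1 * Num.sqrt tb) *: bracket J Vb (vpart x))
       (tb * tpart x).

Lemma transl_lin_linear : linear transl_lin.
Proof.
move=> a x y; rewrite /transl_lin packZ packD !partE bracketDr bracketZr.
move: (bracket _ _ _) (bracket _ _ _) => b1 b2.
by congr (pack _ _ _); [apply/rowP => i; rewrite !mxE; ring..|ring].
Qed.

Local Notation L := (left_transl J (pack Vb Zb tb)).

Lemma left_transl0 : L 0 = pack Vb Zb 0.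
Proof.
by rewrite /left_transl -pack0 !packE bracket0r !scaler0 !addr0 mulr0.
Qed.

Lemma left_translE x : L x = L 0 + transl_lin x.
Proof.
rewrite left_transl0 /left_transl /transl_lin !packE packD add0r.
by rewrite addrA.
Qed.

(** The projective extension acts on homogeneous coordinates linearly, through
    the linear part and the value at [0] of the translation. *)
Lemma range_proj_extension (gam : one_point_compactification R -> 'M[R]_(N + 1))
    (A : set (R * R)) (X : R * R -> 'rV[R]_N) (c : R * R -> R) :
  (forall pq, A pq -> homog (X pq) (c pq) != 0) ->
  range gam = [set hpoint (homog (X pq) (c pq)) | pq in A] ->
  range (proj_extension L \o gam) =
    [set hpoint (homog (transl_lin (X pq) + c pq *: pack Vb Zb 0) (c pq)) | pq in A].
Proof.
move=> Xn gE.
have E pq : A pq -> proj_extension L (hpoint (homog (X pq) (c pq))) =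
    hpoint (homog (transl_lin (X pq) + c pq *: pack Vb Zb 0) (c pq)).
  move=> Apq; rewrite /proj_extension proj_action_hpoint ?Xn //.
  by rewrite (homog_affine_mx _ _ _ _ transl_lin_linear left_translE) left_transl0.
apply/seteqP; split=> [_ [x _ <-]|_ [pq Apq <-]].
  have [pq Apq pqx] : [set hpoint (homog (X pq) (c pq)) | pq in A] (gam x).
    by rewrite -gE; exists x.
  by exists pq => //; rewrite -E // pqx.
have [x _ xE] : range gam (hpoint (homog (X pq) (c pq))) by rewrite gE; exists pq.
by exists x => //=; rewrite xE E.
Qed.

Variables (v : 'rV[R]_n) (s : R).
Hypothesis vs : dot v v = 1 - s ^+ 2.
Hypothesis tb0 : 0 < tb.
Variable gam : one_point_compactification R -> 'M[R]_(N + 1).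
Hypothesis hgam : prolongation J v 0 s gam.

Let chi0 x : chi (0 : 'rV[R]_m) s x = (1 - s * x) ^+ 2.
Proof. by rewrite /chi sqr_enorm dot0l mul0r addr0. Qed.

Let homog_pack a b c : homog (pack (a *: v) (0 : 'rV[R]_m) b) c =
  a *: homog (pack v 0 0) 0 + b *: homog (pack 0 0 1) 0 + c *: homog 0 1.
Proof.
rewrite (homogZ a) (homogZ b) (homogZ c) !packZ !scaler0 !mulr0 !mulr1 -pack0.
rewrite (homogD (pack _ _ _) (pack _ _ _)) (homogD (pack _ _ _ + _)).
by rewrite !packD !addr0 !add0r.
Qed.

Let gamE x : x != s^-1 ->
  1 - s * x != 0 /\
  gam (Some x) = hpoint (homog (pack ((2 * x * (1 - s * x)) *: v) 0 (1 - x ^+ 2))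
                               ((1 - s * x) ^+ 2)).
Proof.
move=> xs; have sx : 1 - s * x != 0.
  apply: contra xs; rewrite subr_eq0 => /eqP sx.
  have s0 : s != 0 by apply: contra_eq_neq sx => ->; rewrite mul0r oner_neq0.
  by rewrite -[x]mul1r -(mulVf s0) -mulrA -sx mulr1.
split => //; have c0 : (1 - s * x) ^+ 2 != 0 by rewrite expf_neq0.
rewrite (proj2 hgam) ?chi0 // affine_pointE //; congr affine_point.
rewrite /geodesic_curve chi0 cliff0l !scaler0 addr0 packZ scaler0 scalerA.
by congr (pack _ _ _); [congr (_ *: _)|]; rewrite mulrC.
Qed.

Lemma eta_parabola : v <> 0 -> parabola_with_infinity (range (proj_extension L \o gam)).
Proof.
move=> /eqP v0; have vv : 1 - s ^+ 2 != 0 by rewrite -vs dot_eq0.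
pose X (pq : R * R) := pack ((2 * pq.1 * (pq.2 - s * pq.1)) *: v) (0 : 'rV[R]_m)
  (pq.2 ^+ 2 - pq.1 ^+ 2).
pose c (pq : R * R) := (pq.2 - s * pq.1) ^+ 2.
pose H p q := homog (X (p, q)) (c (p, q)).
have HE p q : H p q = (2 * p * (q - s * p)) *: homog (pack v 0 0) 0
    + (q ^+ 2 - p ^+ 2) *: homog (pack 0 0 1) 0 + (q - s * p) ^+ 2 *: homog 0 1.
  exact: homog_pack.
have Hn p q : (p != 0) || (q != 0) -> H p q != 0.
  apply: contraTN; rewrite homog_eq0 /c /= sqrf_eq0 subr_eq0 => /andP[/eqP X0 /eqP qE].
  have : tpart (X (p, q)) = 0 by rewrite X0 -pack0 packE.
  rewrite /X packE /= qE => e.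
  have : (1 - s ^+ 2) * p ^+ 2 == 0 by rewrite -oppr_eq0 -e; apply/eqP; ring.
  rewrite mulf_eq0 (negbTE vv) /= sqrf_eq0 => /eqP ->.
  by rewrite mulr0 eqxx.
have rg : range gam = [set hpoint (homog (X pq) (c pq))
    | pq in [set pq : R * R | (pq.1 != 0) || (pq.2 != 0)]].
  apply: etrans (prolongation_range _ gam H 2 s^-1 (proj1 hgam) _ Hn _ _ _) _; last first.
  - by congr image; apply/funext => -[].
  - move=> x /gamE [_ ->]; rewrite /H /X /c /=.
    by rewrite expr1n.
  - move=> l p; apply/differentiable_continuous/derivable1_diffP.
    under eq_fun do rewrite HE !mxE.
    exact: ex_derive.
  - move=> l p; apply/differentiable_continuous/derivable1_diffP.
    under eq_fun do rewrite HE !mxE.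
    exact: ex_derive.
  - move=> k p q; rewrite /H homogZ /X packZ scaler0 scalerA /c /=.
    by congr (homog (pack (_ *: _) _ _) _); ring.
rewrite (range_proj_extension _ _ _ _ _ rg); last by case=> p q; exact: Hn.
(* The tangent direction of the curve at [e] is [transl_lin (v, 0, s)]. Its
   vertical component is a multiple of [w]: [be] is the factor, and the shift
   of the parameter by [be / 2] completes the square, leaving a direction [u]
   orthogonal to [w]. *)
pose be := - 4 * s / (1 - s ^+ 2).
pose u : 'rV[R]_N :=
  pack (Num.sqrt tb *: v) ((2^-1 * Num.sqrt tb) *: bracket J Vb v) 0.
pose w : 'rV[R]_N := pack 0 0 (- tb * (1 - s ^+ 2) / 4).
have st0 : Num.sqrt tb != 0 by rewrite gt_eqF // sqrtr_gt0.
apply: (parabola_homog _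
  (pack Vb Zb tb - (be ^+ 2 / 4) *: w - (be / 2) *: u) u w).
- apply/eqP => /(congr1 (@vpart R n m)); rewrite /u -pack0 !packE => /eqP.
  by rewrite scaler_eq0 (negbTE st0) (negbTE v0).
- apply/eqP => /(congr1 (@tpart R n m)); rewrite /w -pack0 !packE => /eqP.
  by rewrite !mulf_eq0 oppr_eq0 gt_eqF // (negbTE vv) /= invr_eq0 pnatr_eq0.
- by rewrite /u /w dot_pack !dot0r mul0r !addr0.
have key p y : transl_lin (X (p, y + s * p)) + y ^+ 2 *: pack Vb Zb 0 =
  y ^+ 2 *: (pack Vb Zb tb - (be ^+ 2 / 4) *: w - (be / 2) *: u)
  + ((2 * p + be * y / 2) * y) *: u + (2 * p + be * y / 2) ^+ 2 *: w.
  rewrite /transl_lin /X /u /w /= !packE bracketZr !scaler0 add0r.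
  move: (bracket J Vb v) => b1.
  rewrite !(packZ, packN, packD); congr (pack _ _ _).
  + by apply/rowP => i; rewrite !mxE; field.
  + by apply/rowP => i; rewrite !mxE; field.
  + by rewrite /be; field.
apply/seteqP; split=> [_ [[p q] /= pq0 <-]|_ [[x y] /= xy0 <-]].
  exists (2 * p + be * (q - s * p) / 2, q - s * p) => /=; last first.
    by rewrite -key subrK.
  apply: contraTT pq0; rewrite !negb_or !negbK => /andP[/eqP + /eqP h].
  rewrite h mulr0 mul0r addr0 => /eqP; rewrite mulf_eq0 pnatr_eq0 /= => p0.
  by move: h; rewrite (eqP p0) mulr0 subr0 => ->; rewrite !eqxx.
pose p := (x - be * y / 2) / 2.
exists (p, y + s * p) => /=; last first.
  have -> : c (p, y + s * p) = y ^+ 2 by rewrite /c /= addrK.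
  rewrite key; have -> // : 2 * p + be * y / 2 = x by rewrite /p; field.
apply: contraTT xy0; rewrite !negb_or !negbK => /andP[/eqP h].
rewrite h mulr0 addr0 => /eqP y0; move: h; rewrite /p y0 mulr0 mul0r subr0 => /eqP.
by rewrite mulf_eq0 invr_eq0 pnatr_eq0 orbF eqxx andbT.
Qed.

Lemma eta_line : v = 0 -> line_with_infinity (pack 0 0 1) (range (proj_extension L \o gam)).
Proof.
move=> v0; have ss : s ^+ 2 = 1 by move: vs; rewrite v0 dot0l; lra.
have s0 : s != 0 by apply/eqP => s0; move: ss; rewrite s0 expr0n => /eqP; rewrite eq_sym oner_eq0.
pose X (pq : R * R) : 'rV[R]_N := pack 0 0 (pq.2 + s * pq.1).
pose c (pq : R * R) := pq.2 - s * pq.1.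
pose H p q := homog (X (p, q)) (c (p, q)).
have HE p q : H p q = 
    (q + s * p) *: homog (pack 0 0 1) 0 + (q - s * p) *: homog 0 1.
  by have := homog_pack 0 (q + s * p) (q - s * p); rewrite !scale0r add0r.
have Hn p q : (p != 0) || (q != 0) -> H p q != 0.
  apply: contraTN; rewrite homog_eq0 /c /= => /andP[/eqP X0 /eqP e1].
  have : tpart (X (p, q)) = 0 by rewrite X0 -pack0 packE.
  rewrite /X packE /= => e2; have q0 : q = 0 by lra.
  have : s * p == 0 by apply/eqP; lra.
  by rewrite mulf_eq0 (negbTE s0) q0 /= => ->; rewrite eqxx.
have rg : range gam = [set hpoint (homog (X pq) (c pq))
    | pq in [set pq : R * R | (pq.1 != 0) || (pq.2 != 0)]].
  apply: etrans (prolongation_range _ gam H 1 s^-1 (proj1 hgam) _ Hn _ _ _) _; last first.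
  - by congr image; apply/funext => -[].
  - move=> x /gamE [sx ->]; rewrite /H /X /c /= v0 scaler0.
    rewrite -[RHS](hpointZ _ (1 - s * x)) // homogZ packZ !scaler0; congr hpoint.
    have -> : 1 - x ^+ 2 = 1 - s ^+ 2 * x ^+ 2 by rewrite ss mul1r.
    by congr (homog (pack _ _ _) _); ring.
  - move=> l p; apply/differentiable_continuous/derivable1_diffP.
    under eq_fun do rewrite HE !mxE.
    exact: ex_derive.
  - move=> l p; apply/differentiable_continuous/derivable1_diffP.
    under eq_fun do rewrite HE !mxE.
    exact: ex_derive.
  - move=> k p q; rewrite /H homogZ /X packZ !scaler0 /c /=.
    by congr (homog (pack _ _ _) _); ring.
rewrite (range_proj_extension _ _ _ _ _ rg); last by case=> p q; exact: Hn.
apply: (line_homog _ (pack Vb Zb 0) (pack 0 0 1) tb).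
- apply/eqP => /(congr1 (@tpart R n m)); rewrite -pack0 !packE => /eqP.
  by rewrite oner_eq0.
- by rewrite gt_eqF.
have key x : transl_lin (pack 0 0 x) = (x * tb) *: pack 0 0 1.
  rewrite /transl_lin !packE bracket0r !scaler0 addr0 packZ !scaler0 mulr1.
  by rewrite mulrC.
apply/seteqP; split=> [_ [[p q] /= pq0 <-]|_ [[x y] /= xy0 <-]].
  exists (q + s * p, q - s * p) => /=; last by rewrite -key.
  apply: contraTT pq0; rewrite !negb_or !negbK => /andP[/eqP e1 /eqP e2].
  have -> : q == 0 by apply/eqP; lra.
  have : s * p == 0 by apply/eqP; lra.
  by rewrite mulf_eq0 (negbTE s0) /= => ->.
have sE a : s * (s * a) = a by rewrite mulrA -expr2 ss mul1r.
exists (s * ((x - y) / 2), (x + y) / 2) => /=; last first.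
  rewrite /X /c /= sE key.
  have -> : (x + y) / 2 + (x - y) / 2 = x by field.
  by have -> : (x + y) / 2 - (x - y) / 2 = y by field.
apply: contraTT xy0; rewrite !negb_or !negbK mulf_eq0 (negbTE s0) /=.
move=> /andP[/eqP e1 /eqP e2].
have -> : x == 0 by apply/eqP; lra.
by apply/eqP; lra.
Qed.

End Eta.

(** * Lengths of curves and Busemann functions *)

Lemma is_derive_scalel {R : realType} {V : normedModType R} (e : R -> R) (w : V)
    (x de : R) :
  is_derive x 1 e de -> is_derive x 1 (fun y => e y *: w) (de *: w).
Proof.
move=> [ed <-]; have ed' : differentiable e x by apply/derivable1_diffP.
split; first exact/derivable1_diffP/differentiableZl.
by rewrite !deriveE ?diffZl //; exact: differentiableZl.
Qed.

Section Distance.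
Context {R : realType} {n m : nat} (J : clifford_module R n m).
Local Notation N := (n + m + 1)%N.
Local Notation S := (@half_space R n m).
Local Notation G := (dr_metric J).
Implicit Types (p q : 'rV[R]_N) (c : R -> 'rV[R]_N).

(** The squared speed, given by a formula in coordinates that is continuous
    wherever the height does not vanish. *)
Definition speed2 c (y : R) : R :=
  (tpart (c y))^-1 * dot (vpart (derive1 c y)) (vpart (derive1 c y)) +
  (tpart (c y))^-1 * (tpart (c y))^-1 *
    (dot (hat J (c y) (derive1 c y)) (hat J (c y) (derive1 c y))
     + tpart (derive1 c y) * tpart (derive1 c y)).

Lemma curve_lengthE c : C1_curve_in S c ->
  curve_length G c = \int[lebesgue_measure]_(x in `[0, 1]) Num.sqrt (speed2 c x).
Proof.
move=> [_ _ Sc]; apply: eq_Rintegral => x; rewrite inE /= in_itv /= => x01.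
by rewrite innerE_hat //; exact: Sc.
Qed.

Lemma continuous_coord_of (T : topologicalType) k (A : T -> 'rV[R]_k) i (x : T) :
  {for x, continuous A} -> {for x, continuous (fun y => A y 0 i)}.
Proof.
by move=> cA; apply: (@continuous_comp _ _ _ A (fun M : 'rV[R]_k => M 0 i)) => //;
  exact: coord_continuous.
Qed.

Lemma continuous_dot k (A B : R -> 'rV[R]_k) (x : R) :
  (forall i, {for x, continuous (fun y => A y 0 i)}) ->
  (forall i, {for x, continuous (fun y => B y 0 i)}) ->
  {for x, continuous (fun y => dot (A y) (B y))}.
Proof.
by move=> cA cB; apply: continuous_rsum => i; apply: continuousM.
Qed.

Lemma continuous_tpart_of c (x : R) :
  {for x, continuous c} -> {for x, continuous (fun y => tpart (c y))}.
Proof. by move=> cc; rewrite tpart_coordE; exact: continuous_coord_of. Qed.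

Lemma continuous_vpart_of c (x : R) i :
  {for x, continuous c} -> {for x, continuous (fun y => vpart (c y) 0 i)}.
Proof.
move=> cc; rewrite (_ : (fun _ => _) = fun y => c y 0 (lshift 1 (lshift m i))).
  exact: continuous_coord_of.
by apply/funext => y; rewrite vpart_coord.
Qed.

(** The bracket is expanded through [J_Z], since only its coordinates are
    directly seen to be continuous. *)
Lemma continuous_hat c (c' : R -> 'rV[R]_N) (x : R) i :
  {for x, continuous c} -> {for x, continuous c'} ->
  {for x, continuous (fun y => hat J (c y) (c' y) 0 i)}.
Proof.
move=> cc cc'.
rewrite (_ : (fun _ => _) = fun y => c' y 0 (lshift 1 (rshift n i))
   - 2^-1 * dot (\row_j dot (vpart (c y)) (- J (delta_mx 0 i) (delta_mx 0 j)))
                (vpart (c' y))); last first.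
  apply/funext => y; rewrite /hat !mxE; congr (_ - _ * dot _ _).
  apply/rowP => j; rewrite mxE -[LHS]dot_deltar cliff_skew dotNr //.
apply: continuousB; first exact: continuous_coord_of.
apply: continuousM; first exact: cst_continuous.
apply: continuous_dot => j; last exact: continuous_vpart_of.
rewrite (_ : (fun _ => _) =
  fun y => dot (vpart (c y)) (- J (delta_mx 0 i) (delta_mx 0 j))).
  apply: continuous_dot => l; first exact: continuous_vpart_of.
  exact: cst_continuous.
by apply/funext => y; rewrite mxE.
Qed.

Lemma C1_curve_continuous c x : C1_curve_in S c -> {for x, continuous c}.
Proof.
by case=> dc _ _; apply/differentiable_continuous/derivable1_diffP.
Qed.

Lemma continuous_speed c x : C1_curve_in S c -> 0 <= x <= 1 ->
  {for x, continuous (fun y => Num.sqrt (speed2 c y))}.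
Proof.
move=> Cc x01; have [dc cc' Sc] := Cc.
have cc := C1_curve_continuous c x Cc.
have ct := continuous_tpart_of c x cc.
have ct' := continuous_tpart_of _ x (cc' x).
have ctV : {for x, continuous (fun y => (tpart (c y))^-1)}.
  by apply: continuousV => //; rewrite gt_eqF //; exact: Sc.
have cv i := continuous_vpart_of _ x i (cc' x).
have ch i := continuous_hat _ _ x i cc (cc' x).
apply: (@continuous_comp _ _ _ (speed2 c) Num.sqrt); last exact: sqrt_continuous.
apply: continuousD; first by apply: continuousM => //; exact: continuous_dot.
apply: continuousM; first exact: continuousM.
by apply: continuousD; [exact: continuous_dot | exact: continuousM].
Qed.

Lemma is_derive_tpart_of c x : derivable c x 1 ->
  is_derive x 1 (fun y => tpart (c y)) (tpart (derive1 c x)).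
Proof.
move=> dc; rewrite tpart_coordE derive1E derive_mx // mxE.
by apply: derivableP; exact: (iffLR (derivable_mxP c x 1) dc).
Qed.

(** The vertical part of the metric is [dt^2 / t^2], so the speed dominates the
    absolute value of the derivative of [ln t], which is then integrated. *)
Lemma curve_length_ge c : C1_curve_in S c ->
  `|ln (tpart (c 1)) - ln (tpart (c 0))| <= curve_length G c.
Proof.
move=> Cc; have [dc cc' Sc] := Cc; rewrite curve_lengthE //.
pose f y := (tpart (c y))^-1 * tpart (derive1 c y).
have cf (x : R) : 0 <= x <= 1 -> {for x, continuous f}.
  move=> x01; have cc := C1_curve_continuous c x Cc.
  apply: continuousM; last exact: (continuous_tpart_of _ x (cc' x)).
  apply: continuousV; last exact: (continuous_tpart_of _ x cc).
  by rewrite gt_eqF //; exact: Sc.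
have within01 (h : R -> R) : (forall x : R, 0 <= x <= 1 -> {for x, continuous h}) ->
    {within `[0, 1], continuous h}.
  move=> ch; apply: continuous_in_subspaceT => x; rewrite inE /= in_itv /=.
  exact: ch.
have int (h : R -> R) : (forall x : R, 0 <= x <= 1 -> {for x, continuous h}) ->
    lebesgue_measure.-integrable `[0, 1] (EFin \o h).
  move=> ch; apply: continuous_compact_integrable; first exact: segment_compact.
  exact: within01.
pose F y := ln (tpart (c y)).
have dF (x : R) : 0 <= x <= 1 -> is_derive x 1 F (f x).
  move=> x01; have t0 : 0 < tpart (c x) by exact: Sc.
  exact: (@is_derive1_comp _ (@ln R) (fun y => tpart (c y)) x _ _
    (is_derive1_ln t0) (is_derive_tpart_of c x (dc x))).
have cF (x : R) : 0 <= x <= 1 -> {for x, continuous F}.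
  move=> x01; apply/differentiable_continuous/derivable1_diffP.
  by have [] := dF x x01.
have FTC : \int[lebesgue_measure]_(x in `[0, 1]) f x = F 1 - F 0.
  rewrite /Rintegral (@continuous_FTC2 _ f F 0 1) //.
  - exact: within01.
  - split=> [x||].
    + rewrite in_itv /= => /andP[x0 x1].
      by have [] := dF x; rewrite ?(ltW x0) ?(ltW x1).
    + by apply: cvg_at_right_filter; apply: cF; rewrite lexx ler01.
    + by apply: cvg_at_left_filter; apply: cF; rewrite lexx ler01.
  - move=> x; rewrite in_itv /= => /andP[x0 x1].
    by rewrite derive1E; have [] := dF x; rewrite ?(ltW x0) ?(ltW x1).
rewrite -/(F 1) -/(F 0) -FTC.
apply: le_trans (le_normr_Rintegral _ _) _ => //; first exact: int.
apply: le_Rintegral => //.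
- apply: int => x x01; apply: (@continuous_comp _ _ _ f (fun z : R => `|z|)).
    exact: cf.
  exact: norm_continuous.
- by apply: int => x x01; exact: continuous_speed.
move=> x; rewrite /= in_itv /= => x01.
have t0 : 0 < (tpart (c x))^-1 by rewrite invr_gt0; exact: Sc.
rewrite -sqrtr_sqr ler_wsqrtr // /f /speed2 mulrDr addrA exprMn -!expr2 ler_wpDl //.
by rewrite addr_ge0 // !mulr_ge0 ?dot_ge0 ?exprn_ge0 // ltW.
Qed.

Lemma joined_by_length_ge p q l : joined_by_length G S p q l ->
  `|ln (tpart q) - ln (tpart p)| <= l.
Proof.
elim=> [{}p _|c {}q {}l Cc _ IH]; first by rewrite subrr normr0.
apply: le_trans (ler_distD (ln (tpart (c 1))) _ _) _.
by rewrite addrC lerD // curve_length_ge.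
Qed.

Lemma rdist_ge p q l : joined_by_length G S p q l ->
  `|ln (tpart q) - ln (tpart p)| <= rdist G S p q.
Proof.
move=> pq; apply: lb_le_inf; first by exists l.
by move=> k; exact: joined_by_length_ge.
Qed.

Lemma rdist_le p q l : joined_by_length G S p q l -> rdist G S p q <= l.
Proof.
move=> pq; apply: ge_inf => //.
by exists `|ln (tpart q) - ln (tpart p)| => k; exact: joined_by_length_ge.
Qed.

Lemma curve_length_cst c k : C1_curve_in S c ->
  (forall x, 0 <= x <= 1 -> speed2 c x = k) -> curve_length G c = Num.sqrt k.
Proof.
move=> Cc sk; rewrite curve_lengthE //.
under eq_Rintegral => x.
  rewrite inE /= in_itv /= => x01; rewrite sk //; over.
have E : lebesgue_measure (`[0, 1]%classic : set R) = 1%:E.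
  by rewrite lebesgue_measure_itv /= lte_fin ltr01 oppr0 adde0.
by rewrite Rintegral_cst // [X in fine X]E mulr1.
Qed.

(** Vertical segments, parametrized proportionally to arc length. *)
Lemma joined_vertical (V : 'rV[R]_n) (Z : 'rV[R]_m) a b q l :
  joined_by_length G S (pack V Z (expR b)) q l ->
  joined_by_length G S (pack V Z (expR a)) q (`|b - a| + l).
Proof.
move=> jq; pose c r : 'rV[R]_N := pack V Z 0 + expR (r * (b - a) + a) *: pack 0 0 1.
have cE r : c r = pack V Z (expR (r * (b - a) + a)).
  by rewrite /c packZ packD !scaler0 !addr0 add0r mulr1.
have dc (r : R) : is_derive r 1 c ((expR (r * (b - a) + a) * (b - a)) *: pack 0 0 1).
  have d1 : is_derive r 1 (fun r : R => r * (b - a) + a) (b - a).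
    by apply: is_derive_eq; rewrite /GRing.scale /=; ring.
  have d2 := @is_derive1_comp _ expR (fun r => r * (b - a) + a) r _ _
    (is_derive_expR _) d1.
  have d3 : is_derive r 1 (cst (pack V Z 0 : 'rV[R]_N)) 0 by exact: is_derive_cst.
  by have := is_deriveD d3 (is_derive_scalel _ (pack 0 0 1 : 'rV[R]_N) _ _ d2);
    rewrite add0r.
have c'E : derive1 c = fun r => (expR (r * (b - a) + a) * (b - a)) *: pack 0 0 1.
  by apply/funext => r; rewrite derive1E; apply: derive_is.
have Cc : C1_curve_in S c.
  split=> [r||r _]; first by have [] := dc r.
    rewrite c'E => r; apply: differentiable_continuous; apply: differentiableZl.
    by apply/derivable1_diffP; exact: ex_derive.
  by rewrite cE /half_space /= packE expR_gt0.
have len : curve_length G c = `|b - a|.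
  rewrite (curve_length_cst c ((b - a) ^+ 2)) // ?sqrtr_sqr // => r _.
  rewrite /speed2 c'E cE /hat packZ !scaler0 mulr1 !packE.
  rewrite bracket0r scaler0 subr0 !dot0l mulr0 !add0r.
  by field; rewrite gt_eqF // expR_gt0.
have j1 : joined_by_length G S (c 1) q l by rewrite cE mul1r subrK.
by have := JoinedCons Cc j1; rewrite len cE mul0r add0r.
Qed.

(** Euclidean segments in a horizontal hyperplane that head for the [t]-axis;
    they have constant speed because [[V, V] = 0]. *)
Lemma joined_horizontal (V : 'rV[R]_n) (Z : 'rV[R]_m) t : 0 < t ->
  joined_by_length G S (pack V Z t) (pack 0 0 t)
    (Num.sqrt (dot V V * t^-1 + dot Z Z * t^-1 ^+ 2)).
Proof.
move=> t0; pose w : 'rV[R]_N := pack (- V) (- Z) 0.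
pose c (r : R) : 'rV[R]_N := pack V Z t + r *: w.
have cE r : c r = pack (V - r *: V) (Z - r *: Z) t.
  by rewrite /c packZ packD !scalerN mulr0 addr0.
have dc (r : R) : is_derive r 1 c w.
  apply: is_derive_affine => h; rewrite /c scalerDl addrCA addrC.
  by rewrite [h *: 1]mulr1.
have c'E : derive1 c = fun _ => w.
  by apply/funext => r; rewrite derive1E; apply: derive_is.
have Cc : C1_curve_in S c.
  split=> [r||r _]; first by have [] := dc r.
    by rewrite c'E => r; exact: cst_continuous.
  by rewrite cE /half_space /= packE.
have len : curve_length G c = Num.sqrt (dot V V * t^-1 + dot Z Z * t^-1 ^+ 2).
  apply: curve_length_cst => // r _.
  rewrite /speed2 c'E cE /hat !packE.
  rewrite bracketNr bracketDl bracketNl bracketZl bracketxx scaler0 subr0 oppr0.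
  by rewrite scaler0 subr0 !dotE; ring.
have j1 : joined_by_length G S (c 1) (pack 0 0 t) 0.
  rewrite cE !scale1r !subrr; apply: JoinedNil.
  by rewrite /half_space /= packE.
by have := JoinedCons Cc j1; rewrite len cE !scale0r !subr0 addr0.
Qed.

Lemma rdist_vertical (V : 'rV[R]_n) (Z : 'rV[R]_m) a b :
  rdist G S (pack V Z (expR a)) (pack V Z (expR b)) = `|b - a|.
Proof.
have j : joined_by_length G S (pack V Z (expR a)) (pack V Z (expR b)) `|b - a|.
  rewrite -[`|b - a|]addr0; apply: joined_vertical; apply: JoinedNil.
  by rewrite /half_space /= packE expR_gt0.
apply/eqP; rewrite eq_le rdist_le //=.
by have := rdist_ge _ _ _ j; rewrite !packE !expRK.
Qed.

Definition vertical_ray (x : R) : 'rV[R]_N := pack 0 0 (expR x).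

Lemma vertical_geodesic_ray : geodesic_ray G S vertical_ray.
Proof.
split=> [x _|x y _ _]; first by rewrite /half_space /= packE expR_gt0.
by rewrite rdist_vertical distrC.
Qed.

(** The path that first climbs to height [exp x] and then goes horizontally to
    the ray is longer than the lower bound [x - ln t] by a quantity that tends
    to [0]. *)
Lemma busemann_vertical p : S p -> busemann G S vertical_ray p = - ln (tpart p).
Proof.
move=> p0; apply: cvg_lim => //.
pose V := vpart p; pose Z := zpart p; pose a := ln (tpart p).
have pE : p = pack V Z (expR a) by rewrite /a lnK ?posrE // pack_parts.
pose k (y : R) := Num.sqrt (dot V V * y + dot Z Z * y ^+ 2).
have j x : joined_by_length G S p (vertical_ray x) (`|x - a| + k (expR (- x))).
  rewrite pE; apply: joined_vertical; rewrite /k expRN.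
  by apply: joined_horizontal; rewrite expR_gt0.
have k0 : k (expR (- x)) @[x --> +oo] --> 0.
  have -> : 0 = k 0 by rewrite /k expr0n !mulr0 addr0 sqrtr0.
  apply: (@continuous_cvg _ _ _ _ _ (fun x => expR (- x)) k); last exact: cvgr_expR.
  apply: (@continuous_comp _ _ _ (fun y => dot V V * y + dot Z Z * y ^+ 2) Num.sqrt).
    by apply/differentiable_continuous/derivable1_diffP; exact: ex_derive.
  exact: sqrt_continuous.
apply: (@squeeze_cvgr _ _ _ _ (fun=> - a) (fun x => - a + k (expR (- x)))).
- near=> x.
  have ax : a <= x by near: x; apply: nbhs_pinfty_ge; exact: num_real.
  have := rdist_ge _ _ _ (j x); have := rdist_le _ _ _ (j x).
  rewrite {2}/vertical_ray packE expRK -/a ger0_norm ?subr_ge0 // => h1 h2.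
  by apply/andP; split; lra.
- exact: cvg_cst.
- by rewrite -[X in _ --> X]addr0; apply: cvgD => //; exact: cvg_cst.
Unshelve. all: by end_near. Qed.

End Distance.

(** * The proposition *)

Theorem proposition8p2 (R : realType) (n m : nat) (J : clifford_module R n m)
    (Vb : 'rV[R]_n) (Zb : 'rV[R]_m) (tb : R) (htb : 0 < tb)
    (v : 'rV[R]_n) (s : R) (hunit : enorm (pack v (0 : 'rV[R]_m) s) = 1)
    (gam : one_point_compactification R -> 'M[R]_(n + m + 1 + 1))
    (hgam : prolongation J v 0 s gam) :
  let S : set 'rV[R]_(n + m + 1) := @half_space R n m in
  let G := dr_metric J in
  let eta := proj_extension (left_transl J (pack Vb Zb tb)) \o gam in
  let D := Dstar J Vb tb v s in
  let F := Fstar J Vb tb v s in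
  let eA : 'rV[R]_(n + m + 1) := pack 0 0 1 in
  isoparametric G S D /\
  (* (i) *)
  ~ has_max_on S D /\
  (* (ii) *)
  (v <> 0 <-> parabola_with_infinity (range eta)) /\
  (v <> 0 ->
    let K := focal_direction J v in
    let a : 'rV[R]_(n + m + 1) :=
      pack (Vb + (2 * s * Num.sqrt tb / enorm v ^+ 2) *: v) 0 0 in
    is_min_on S D 0 /\
    (forall A, focal_variety G S D A <-> A = F) /\
    @minimal_submanifold R n _ G S F /\
    F = S `&` [set a + x | x in K] /\
    K = orthocomp [set pack (J Z v + c *: v) 0 0
                    | Z in [set: 'rV[R]_m] & c in [set: R]] /\
    affine_subspace n [set a + x | x in K]) /\
  (* (iii) *)
  ((v = 0 /\ (s = 1 \/ s = -1)) <->
    exists u : 'rV[R]_(n + m + 1),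
      (forall w : 'rV[R]_(n + m + 1), tpart w = 0 -> dot u w = 0) /\
      line_with_infinity u (range eta)) /\
  (v = 0 -> s = 1 \/ s = -1 ->
    (forall V Z t, 0 < t -> D (pack V Z t) = 4 * tb / t) /\
    (~ exists c, is_min_on S D c) /\
    (forall A, ~ focal_variety G S D A) /\
    let levels := [set A | exists p, S p /\ A = level_set S D (D p)] in
    parallel_horospheres G S levels /\
    (forall A, levels A -> exists h : R, A = [set x | dot x eA = h])).
Proof.
have vs : dot v v = 1 - s ^+ 2.
  have : enorm (pack v (0 : 'rV[R]_m) s) ^+ 2 = 1 by rewrite hunit expr1n.
  by rewrite sqr_enorm dot_pack dot0l addr0 -expr2 => <-; rewrite addrK.
have s1 : v = 0 -> s = 1 \/ s = -1.
  move=> v0; have /eqP : s ^+ 2 = 1 by move: vs; rewrite v0 dot0l; lra.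
  by rewrite sqrf_eq1 => /orP[] /eqP; [left | right].
move=> S G eta D F eA.
have DE : D = Dquot J Vb v (2 * s * Num.sqrt tb) by exact: DstarE.
have FE : F = level_set S D 0 by rewrite DE; exact: FstarE.
have D0 (p : 'rV[R]_(n + m + 1)) : v = 0 -> D p = 4 * tb / tpart p.
  move=> v0; rewrite DE /Dquot /Dnum v0 dot0r bracket0r dot0l subr0 addr0.
  rewrite !exprMn sqr_sqrtr ?ltW //.
  have -> : s ^+ 2 = 1 by move: vs; rewrite v0 dot0l; lra.
  by rewrite mulr1 mulrC -natrX.
have par : v <> 0 -> parabola_with_infinity (range eta).
  by move=> v0; apply: (eta_parabola _ _ _ _ _ _ vs htb _ hgam).
have line : v = 0 -> line_with_infinity eA (range eta).
  by move=> v0; apply: (eta_line _ _ _ _ _ _ vs htb _ hgam).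
split; first by rewrite DE; exact: isoparametric_Dquot.
split.
  rewrite DE; have [v0|/eqP v0] := eqVneq v 0.
    apply: (@no_max_Dquot _ _ _ _ _ _ _ Vb).
    rewrite /Dnum v0 dot0r bracket0r dot0l addr0 subr0 exprn_even_gt0 //=.
    rewrite !mulf_neq0 ?pnatr_eq0 ?(gt_eqF (sqrtr_gt0 _)) //.
      by case: (s1 v0) => ->; rewrite ?oppr_eq0 oner_eq0.
    by rewrite gt_eqF // sqrtr_gt0.
  apply: (@no_max_Dquot _ _ _ _ _ _ _
    (Vb + ((2 * s * Num.sqrt tb - 1) / dot v v) *: v)).
  rewrite /Dnum addrAC subrr add0r dotZl divfK ?dot_eq0; last exact/eqP.
  by rewrite ltr_wpDr ?dot_ge0 // opprB addrC subrK expr1n.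
split.
  split=> // pa v0; have [u0 _] := line v0.
  exact: parabola_not_line pa (line v0).
split.
  move=> v0 K a; have Fne : F !=set0 by exact: Fstar_nonempty.
  have FK : F = S `&` [set a + x | x in K] by exact: Fstar_affine.
  have [P [Pf PK]] := focal_basis J v v0.
  split; first by rewrite DE; apply: min_Dquot; rewrite -DE -FE.
  split.
    move=> A; rewrite DE focal_Dquot -DE -FE.
    by split=> [[]//|->]; split.
  split.
    apply: minimal_affine Pf PK _ FK => w t.
    by rewrite /focal_direction /= packE bracket0r dot0l.
  split; first exact: FK.
  split; first exact: focal_directionE.
  exact: affine_subspace_rows Pf PK.
split.
  split=> [[v0 _]|[u [_ uline]]].
    exists eA; split; last exact: line.
    by move=> w w0; rewrite dot_parts !packE w0 !dot0l mulr0 !addr0.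
  have v0 : v = 0.
    by apply: contrapT => v0; apply: parabola_not_line (par v0) uline.
  by split => //; exact: s1.
move=> v0 _; split; first by move=> V Z t _; rewrite D0 // packE.
have Dpos p : S p -> 0 < D p.
  by move=> p0; rewrite D0 // divr_gt0 // mulr_gt0.
split.
  move=> [c [[p [p0 pc]] cmin]].
  have c0 : 0 < c by rewrite -pc; exact: Dpos.
  have t0 : 0 < 4 * tb / (c / 2) by rewrite !divr_gt0 // mulr_gt0.
  have := cmin (pack 0 0 (4 * tb / (c / 2))).
  rewrite D0 // packE => /(_ _); rewrite /S /half_space /= packE => /(_ t0).
  rewrite invf_div mulrA mulrAC divff ?mul1r; last by rewrite gt_eqF // mulr_gt0.
  by apply/negP; rewrite -ltNge; lra.
split.
  move=> A; rewrite DE focal_Dquot -DE => -[_ [p [p0 pD]]].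
  by have := Dpos p p0; rewrite pD ltxx.
have lev p q : S p -> S q -> (D q = D p) <-> tpart q = tpart p.
  move=> p0 q0; rewrite !D0 //; split=> [|-> //].
  move/(mulfI _) => h; apply: invr_inj; apply: h.
  by rewrite gt_eqF // mulr_gt0.
move=> levels; split.
  exists (vertical_ray); split; first exact: vertical_geodesic_ray.
  move=> _ [p [p0 ->]]; exists (- ln (tpart p)).
  apply/seteqP; split=> q [q0 e]; split => //.
    by rewrite busemann_vertical //; congr (- ln _); apply/lev.
  apply/lev => //; move: e; rewrite busemann_vertical // => /oppr_inj.
  by apply: ln_inj; rewrite posrE.
move=> _ [p [p0 ->]]; exists (tpart p).
apply/seteqP; split=> q /=; rewrite dot_parts !packE !dot0r mulr1 !add0r.
  by move=> [q0 e]; apply/lev.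
move=> e; have q0 : S q by rewrite /S /half_space /= e.
by split => //; apply/lev.
Qed.
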